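(* Let $N \geqslant 2$ be an integer, let $\mathcal{D} \subset \{0,1,\ldots,N-1\}^2$ be non-empty, and suppose the fractal square $F=F(N,\mathcal{D})$ is disconnected. Let $G_F$ and $G'_F$ be its level-1 and level-2 graphs. Then $F$ has finitely many connected components if and only if $\#\mathscr{C}(G_F)=\#\mathscr{C}(G'_F)$. Further, in the case that $\#\mathscr{C}(G_F)=\#\mathscr{C}(G'_F)$, the number $\#\mathscr{C}(F)$ equals this common value.
   Context: For an integer $N\geqslant 2$ and a non-empty $\mathcal{D} \subset \{0,1,\ldots,N-1\}^2$, put $\varphi_d(x)=(x+d)/N$ for $d\in\mathcal{D}$, $x\in\mathbb{R}^2$. The fractal square $F=F(N,\mathcal{D})$ is the unique non-empty compact set $F\subset\mathbb{R}^2$ with $F=\bigcup_{d\in\mathcal{D}}\varphi_d(F)$. For a set $A\subset\mathbb{R}^2$, $\mathscr{C}(A)$ denotes the collection of connected components of $A$; $\#$ denotes cardinality. A set $\mathcal{A}\subset\mathcal{D}$ is called connected if for any $d,d'\in\mathcal{A}$ there exist $d_1,\ldots,d_n\in\mathcal{A}$ with $d_1=d$, $d_n=d'$ and $\varphi_{d_i}(F)\cap\varphi_{d_{i+1}}(F)\neq\varnothing$ for $1\leqslant i\leqslant n-1$. Maximal (by inclusion) connected subsets of $\mathcal{D}$ are its connected components, written $\mathcal{D}_1,\ldots,\mathcal{D}_m$ (when $F$ is disconnected, $m\geqslant 2$). Put $F_i=\bigcup_{d\in\mathcal{D}_i}\varphi_d(F)$ for $1\leqslant i\leqslant m$. The level-1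 graph $G_F$ has vertex set $\{(d,i): d\in\mathcal{D},\,1\leqslant i\leqslant m\}$, with an edge joining $(d_1,i_1)$ and $(d_2,i_2)$ if and only if $\varphi_{d_1}(F_{i_1})\cap\varphi_{d_2}(F_{i_2})\neq\varnothing$. For a graph $G$, $\mathscr{C}(G)$ is the collection of its connected components, regarded as sets of vertices. Write $\mathscr{C}(G_F)=\{\mathcal{C}_1,\ldots,\mathcal{C}_M\}$ and put $F^*_j=\bigcup_{(d,i)\in\mathcal{C}_j}\varphi_d(F_i)$ for $1\leqslant j\leqslant M$. The level-2 graph $G'_F$ has vertex set $\{\langle d,j\rangle: d\in\mathcal{D},\,1\leqslant j\leqslant M\}$, with an edge joining $\langle d_1,j_1\rangle$ and $\langle d_2,j_2\rangle$ if and only if $\varphi_{d_1}(F^*_{j_1})\cap\varphi_{d_2}(F^*_{j_2})\neq\varnothing$. *)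

(* Defs.v *)
From HB Require Import structures.
From mathcomp Require Import all_boot all_order all_algebra.
From mathcomp Require Import all_classical all_reals all_analysis.

Set Implicit Arguments.
Unset Strict Implicit.
Unset Printing Implicit Defensive.

Import Order.TTheory GRing.Theory Num.Theory.
Import numFieldNormedType.Exports.

Local Open Scope classical_set_scope.
Local Open Scope ring_scope.

Definition components (T : topologicalType) (A : set T) : set (set T) :=
  [set connected_component A x | x in A].

(** In the graph with vertex set [V] and adjacency [e], any two vertices of
    [A] are joined by a walk that stays in [A]. *)
Definition connected_in (T : finType) (V : {set T}) (e : rel T)
    (A : {set T}) : bool :=
  (A \subset V) &&
  [forall x in A, forall y in A,
    connect [rel u v | [&& u \in A, v \in A & e u v]] x y].

(** The empty set counts as connected, hence it is never maximal as soon as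
    [V] is non-empty. *)
Definition graph_components (T : finType) (V : {set T}) (e : rel T)
    : {set {set T}} :=
  [set A : {set T} | maxset (connected_in V e) A]%SET.

Notation digit N := ('I_N * 'I_N)%type.

Definition phi (R : realType) (N : nat) (d : digit N) (x : R * R) : R * R :=
  ((x.1 + d.1%:R) / N%:R, (x.2 + d.2%:R) / N%:R).

Definition fractal_square (R : realType) (N : nat) (D : {set digit N})
    (F : set (R * R)) : Prop :=
  [/\ F !=set0, compact F & F = \bigcup_(d in [set` D]) (phi d @` F)].

Definition digit_adj (R : realType) (N : nat) (F : set (R * R)) : rel (digit N) :=
  fun d d' => `[< (phi d @` F) `&` (phi d' @` F) !=set0 >].

Definition digit_components (R : realType) (N : nat) (D : {set digit N})
    (F : set (R * R)) : {set {set digit N}} :=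
  graph_components D (digit_adj F).

(** [F_i], where [D_1, ..., D_m] are enumerated by [enum_val]. *)
Definition piece (R : realType) (N : nat) (D : {set digit N})
    (F : set (R * R)) (i : 'I_#|digit_components D F|) : set (R * R) :=
  \bigcup_(d in [set` enum_val i]) (phi d @` F).

(** Both level graphs have the same shape: pairs of a digit and an index into a
    family [P] of plane sets. *)
Definition level_vertices (N : nat) (D : {set digit N}) (I : finType)
    : {set digit N * I} :=
  [set v : digit N * I | v.1 \in D]%SET.

Definition level_adj (R : realType) (N : nat) (I : finType)
    (P : I -> set (R * R)) : rel (digit N * I) :=
  fun v w => `[< (phi v.1 @` P v.2) `&` (phi w.1 @` P w.2) !=set0 >].

Definition level1_components (R : realType) (N : nat) (D : {set digit N})
    (F : set (R * R)) : {set {set digit N * 'I_#|digit_components D F|}} :=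
  graph_components (level_vertices D _) (level_adj (@piece R N D F)).

(** [F*_j], where the components of the level-1 graph are enumerated by
    [enum_val]. *)
Definition star_piece (R : realType) (N : nat) (D : {set digit N})
    (F : set (R * R)) (j : 'I_#|level1_components D F|) : set (R * R) :=
  \bigcup_(v in [set` enum_val j]) (phi v.1 @` piece v.2).

Definition level2_components (R : realType) (N : nat) (D : {set digit N})
    (F : set (R * R)) : {set {set digit N * 'I_#|level1_components D F|}} :=
  graph_components (level_vertices D _) (level_adj (@star_piece R N D F)).

(* Main.v *)
Require Import Defs.
From HB Require Import structures.
From mathcomp Require Import all_boot all_order all_algebra.
From mathcomp Require Import all_classical all_reals all_analysis.
From mathcomp Require Import zify ring lra.

Set Implicit Arguments.
Unset Strict Implicit.
Unset Printing Implicit Defensive.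

Import Order.TTheory GRing.Theory Num.Theory.
Import numFieldNormedType.Exports.

Local Open Scope classical_set_scope.
Local Open Scope card_scope.
Local Open Scope ring_scope.

(** Let [E] be an equivalence relation on [F], and let its refinement be the
    equivalence generated by [phi d a ~ phi d b] for [d] in [D] and [E a b].
    Starting from the total relation, the classes of the successive refinements
    [E1], [E2], [E3] are the sets [F_i], [F*_j] and the unions attached to the
    components of the level-2 graph. They are clopen, so components of [F]
    are contained in them; and if [E2 = E3], then points of a class are linked
    by chains of arbitrarily small steps, so classes of [E2] are components.

    Conversely let [F] have finitely many components, at least two. A component
    whose copies could be isolated in cells that shrink to a point would yield
    infinitely many components; choosing extreme digits of [D], this shows that
    each component joins two opposite sides of the unit square. Crossing
    components intersect, so up to transposition all of them join the left and
    right sides and none joins the top and the bottom. They are therefore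
    linearly ordered, only the uppermost one meets a copy of [F] placed above,
    and only the lowermost one meets a copy placed below. In a maximal
    horizontal run of [l] cells that is not a full row, every strand is then
    connected inside the run to an uppermost or a lowermost strand. If these two
    were still disconnected in a row of [l + 1] copies, they would be separated
    by a set invariant under horizontal contact, which would force all
    components to be flat. Hence at most one run length [l] admits two parts,
    and all other cells lie in one component of [F]. Either some class of [E1]
    meets both parts of a column of such a run, and then [E2 = E1], or none
    does; in both cases classes of [E2] are components. *)

(** * Generated equivalences and plane topology *)

Section Span.
Context {T : Type}.
Implicit Types S Q : T -> T -> Prop.

Definition equivalence_on Q :=
  [/\ forall x, Q x x, forall x y, Q x y -> Q y x
    & forall x y z, Q x y -> Q y z -> Q x z].

(** Impredicative form of the generated equivalence, so that induction along chains is a mere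
    instantiation of [Q]. *)
Definition eqv_span S (x y : T) :=
  forall Q, equivalence_on Q -> (forall u v, S u v -> Q u v) -> Q x y.

Lemma eqv_span_incl S x y : S x y -> eqv_span S x y.
Proof. by move=> Sxy Q _; apply. Qed.

Lemma eqv_span_min S Q : equivalence_on Q -> (forall u v, S u v -> Q u v) ->
  forall x y, eqv_span S x y -> Q x y.
Proof. by move=> eQ SQ x y; apply. Qed.

Lemma eqv_span_equiv S : equivalence_on (eqv_span S).
Proof.
split=> [x Q [r _ _] _|x y Sxy Q eQ SQ|x y z Sxy Syz Q eQ SQ]; first exact: r.
- by have [_ s _] := eQ; apply: s; apply: Sxy.
- by have [_ _ t] := eQ; apply: t (Sxy _ eQ SQ) (Syz _ eQ SQ).
Qed.

Lemma eqv_span_refl S x : eqv_span S x x.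
Proof. by have [r _ _] := eqv_span_equiv S. Qed.

Lemma eqv_span_sym S x y : eqv_span S x y -> eqv_span S y x.
Proof. by have [_ s _] := eqv_span_equiv S; apply: s. Qed.

Lemma eqv_span_trans S y x z : eqv_span S x y -> eqv_span S y z -> eqv_span S x z.
Proof. by have [_ _ t] := eqv_span_equiv S; apply: t. Qed.

Lemma eqv_span_mono S S' : (forall x y, S x y -> S' x y) ->
  forall x y, eqv_span S x y -> eqv_span S' x y.
Proof.
by move=> SS'; apply: eqv_span_min; [exact: eqv_span_equiv|move=> u v /SS'; exact: eqv_span_incl].
Qed.

(** Fed to [eqv_span_min], this carries a predicate along a chain. *)
Lemma equivalence_on_iff (P : T -> Prop) : equivalence_on (fun x y => P x <-> P y).
Proof. by split=> //; [move=> x y []|move=> x y z [? ?] [? ?]; split; auto]. Qed.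

End Span.

Lemma equivalence_on_preim (T U : Type) (f : U -> T) (Q : T -> T -> Prop) :
  equivalence_on Q -> equivalence_on (fun x y => Q (f x) (f y)).
Proof. by move=> [r s t]; split=> // [x y|x y z]; [exact: s|exact: t]. Qed.

Section PlaneTopology.
Context {R : realType}.
Implicit Types (A B C : set (R * R)) (x y z : R * R) (e : R).

Definition within_dist e x y := `|x.1 - y.1| < e /\ `|x.2 - y.2| < e.

Lemma within_dist_ball e x y : within_dist e x y <-> ball x e y.
Proof. by rewrite /within_dist /ball /= /prod_ball -!ball_normE. Qed.

Lemma within_dist_sym e x y : within_dist e x y -> within_dist e y x.
Proof. by move=> [? ?]; split; rewrite distrC. Qed.

Lemma hausdorff_plane : hausdorff_space (R * R)%type.
Proof. exact: norm_hausdorff. Qed.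

Lemma closed_approx A x : closed A ->
  (forall e, 0 < e -> exists2 y, A y & within_dist e x y) -> A x.
Proof.
move=> cA h; apply: cA => B /nbhs_ballP[e /= e0 eB].
have [y Ay /within_dist_ball xy] := h e e0.
by exists y; split => //; apply: eB.
Qed.

(** The part of [A] where [P] holds and the part where it fails are both relatively open, since
    neither can be left by a step shorter than [e]. *)
Lemma connected_step_ind A (P : R * R -> Prop) a e :
  connected A -> 0 < e -> A a -> P a ->
  (forall x y, A x -> A y -> within_dist e x y -> P x -> P y) ->
  forall y, A y -> P y.
Proof.
move=> cA e0 Aa Pa step y Ay.
suff AP : A `&` [set z | P z] = A.
  by have : A y by []; rewrite -AP => -[].
apply: cA; first by exists a.
- exists (\bigcup_(x in A `&` [set z | P z]) ball x e).
    by apply: bigcup_open => x _; exact: ball_open.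
  apply/seteqP; split=> [x [Ax Px]|x [Ax [z [Az Pz] /within_dist_ball zx]]].
    by split=> //; exists x => //; exact: ballxx.
  by split=> //; exact: step zx Pz.
- exists (~` \bigcup_(x in A `\` [set z | P z]) ball x e).
    by apply: open_closedC; apply: bigcup_open => x _; exact: ball_open.
  apply/seteqP; split=> [x [Ax Px]|x [Ax nx]].
    split=> // -[z [Az nPz] /within_dist_ball zx]; apply: nPz.
    exact: step (within_dist_sym zx) Px.
  split=> //=; apply: contrapT => nPx; apply: nx; exists x => //; exact: ballxx.
Qed.

(** The set of differences is compact, hence closed; arbitrarily close pairs would put 0 into it. *)
Lemma compact_dist A B : compact A -> compact B -> A `&` B = set0 ->
  exists2 e, 0 < e & forall x y, A x -> B y -> ~ within_dist e x y.
Proof.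
move=> cA cB AB0.
have cD : compact ((fun p : (R * R) * (R * R) => p.1 - p.2) @` (A `*` B)).
  apply: continuous_compact; last exact: compact_setX.
  apply: continuous_subspaceT => p.
  by apply: continuousB; [exact: cvg_fst|exact: cvg_snd].
apply: contrapT => /forall2NP nh.
have [p [/= Ap Bp] /eqP] : ((fun p : (R * R) * (R * R) => p.1 - p.2) @` (A `*` B)) 0.
  apply: closed_approx; first exact: (compact_closed hausdorff_plane).
  move=> e e0; case: (nh e) => // /existsNP[x /existsNP[y /not_implyP[Ax /not_implyP[By /contrapT [h1 h2]]]]].
  exists (x - y); first by exists (x, y).
  by split; rewrite /= sub0r normrN.
rewrite subr_eq0 => /eqP pE; have : (A `&` B) p.1 by split=> //; rewrite pE.
by rewrite AB0.
Qed.

Lemma within_dist_continuous (f : R * R -> R * R) :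
  (forall e x y, 0 < e -> within_dist e x y -> within_dist e (f x) (f y)) ->
  continuous f.
Proof.
move=> fL x B /nbhs_ballP[e /= e0 eB]; apply/nbhs_ballP; exists e => //= y.
by move=> /within_dist_ball/(fL _ _ _ e0)/within_dist_ball/eB.
Qed.

Lemma within_dist_le e e' x y : e <= e' -> within_dist e x y -> within_dist e' x y.
Proof. by move=> ee' [? ?]; split; apply: lt_le_trans ee'. Qed.

Lemma connected_sub_clopen A B G z : connected A -> A `<=` B ->
  closed (B `&` G) -> closed (B `&` ~` G) -> A z -> G z -> A `<=` G.
Proof.
move=> cA AB cG cG' Az Gz; suff <- : A `&` G = A by exact: subIsetr.
apply: cA; first by exists z.
- exists (~` (B `&` ~` G)); first by rewrite openC.
  apply/seteqP; split=> x [Ax Gx]; split=> //; first by case.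
  by apply: contrapT => nGx; apply: Gx; split=> //; exact: AB.
- exists (B `&` G) => //; apply/seteqP; split=> x [Ax].
    by move=> Gx; do ?split=> //; exact: AB.
  by case.
Qed.

End PlaneTopology.

(** * Crossing parity of lattice paths *)

Section Parity.
Implicit Types (u v w a : int * int) (s : seq (int * int)).

(** Points whose coordinates differ by less than 1 have floors adjacent in this sense, so connected
    sets discretise to [king] paths. *)
Definition king u v := (`|u.1 - v.1| <= 1) && (`|u.2 - v.2| <= 1).

Lemma kingC u v : king u v = king v u.
Proof. by rewrite /king distrC (distrC u.2). Qed.

Fixpoint par (c : int * int -> int * int -> bool) u s :=
  if s is v :: s' then c u v (+) par c v s' else false.

Lemma par_telescope g u s : par (fun v w => g v (+) g w) u s = g u (+) g (last u s).
Proof.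
elim: s u => [|v s IH] u /=; first by rewrite addbb.
by rewrite IH -addbA (addbA (g v)) addbb addFb.
Qed.

Lemma par_addb c c' u s :
  par (fun v w => c v w (+) c' v w) u s = par c u s (+) par c' u s.
Proof. by elim: s u => [|v s IH] u //=; rewrite IH addbACA. Qed.

Lemma par_rcons c u s v : par c u (rcons s v) = par c u s (+) c (last u s) v.
Proof. by elim: s u => [|w s IH] u /=; rewrite ?addbF // IH addbA. Qed.

Lemma par_false u s : par (fun _ _ => false) u s = false.
Proof. by elim: s u => //=. Qed.

Lemma eq_par c c' (P : pred (int * int)) u s :
  (forall v w, P v -> P w -> king v w -> c v w = c' v w) ->
  P u -> all P s -> path king u s -> par c u s = par c' u s.
Proof.
move=> cc'; elim: s u => [|v s IH] u //= Pu /andP[Pv Ps] /andP[uv vs].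
by rewrite (cc' u v) // IH.
Qed.

(** The step from [u] to [w] crosses the vertical line between the columns [x]
    and [x + 1], at a point whose left neighbour lies above height [y]. *)
Definition crosses (x y : int) u w :=
  [&& u.1 == x, w.1 == x + 1 & y < u.2] || [&& w.1 == x, u.1 == x + 1 & y < w.2].

(** Raising the height by one affects only an end of the step at [(x, y + 1)]. *)
Lemma crosses_vert x y v w : v != (x, y + 1) -> w != (x, y + 1) ->
  crosses x y v w = crosses x (y + 1) v w.
Proof.
case: v w => v1 v2 [w1 w2]; rewrite /crosses !xpair_eqE /= => hv hw.
have E (c d : int) : ~~ ((c == x) && (d == y + 1)) ->
    (c == x) && (y < d) = (c == x) && (y + 1 < d).
  by case: eqP => //= _; lia.
have {}hv := E _ _ hv; have {}hw := E _ _ hw.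
by congr orb; rewrite andbCA ?hv ?hw andbCA.
Qed.

(** The ray of column [x + 1] above [y] is entered or left through the line on its left or on its
    right. A step between the columns [x] and [x + 1] that avoids both points at height [y] has both
    ends above or both below, so its height may be read in either column. *)
Lemma crosses_horiz x y v w : king v w ->
  v != (x, y) -> v != (x + 1, y) -> w != (x, y) -> w != (x + 1, y) ->
  ((v.1 == x + 1) && (y < v.2)) (+) ((w.1 == x + 1) && (y < w.2)) =
  crosses x y v w (+) crosses (x + 1) y v w.
Proof.
case: v w => v1 v2 [w1 w2]; rewrite /king /crosses !xpair_eqE /= !ler_norml.
move=> /andP[/andP[k1 k2] /andP[k3 k4]].
have x1 : (x == x + 1) = false by lia.
have x1' : (x + 1 == x) = false by lia.
have x2 : (x == x + 1 + 1) = false by lia.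
have x2' : (x + 1 + 1 == x) = false by lia.
have x3 : (x + 1 + 1 == x + 1) = false by lia.
have x3' : (x + 1 == x + 1 + 1) = false by lia.
case: (eqVneq v1 (x + 1)) k1 k2 => [-> k1 k2|nv1 k1 k2];
  case: (eqVneq w1 (x + 1)) k1 k2 => [-> k1 k2|nw1 k1 k2];
  rewrite ?eqxx ?x1 ?x1' ?x2 ?x2' ?x3 ?x3' ?andbF ?andbT ?orbF /= ?addbF ?addFb; lia.
Qed.

Lemma par_crosses_vert x y u s :
  path king u s -> (x, y + 1) \notin u :: s ->
  par (crosses x y) u s = par (crosses x (y + 1)) u s.
Proof.
move=> kp; rewrite inE negb_or eq_sym => /andP[Pu Ps].
apply: (eq_par (P := fun v => v != (x, y + 1))) kp => //; last first.
  by apply/allP => v vs; apply: contraNneq Ps => <-.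
by move=> v w Pv Pw _; exact: crosses_vert.
Qed.

(** The parities differ by the telescoping sum from [crosses_horiz], which vanishes because both
    ends of the path lie outside column [x + 1]. *)
Lemma par_crosses_horiz x y u s :
  path king u s -> (x, y) \notin u :: s -> (x + 1, y) \notin u :: s ->
  u.1 != x + 1 -> (last u s).1 != x + 1 ->
  par (crosses x y) u s = par (crosses (x + 1) y) u s.
Proof.
move=> kp nv nv' hu hl.
pose g (v : int * int) := (v.1 == x + 1) && (y < v.2).
have g0 : g u (+) g (last u s) = false by rewrite /g (negPf hu) (negPf hl).
suff : par (crosses x y) u s (+) par (crosses (x + 1) y) u s = false.
  by do 2 case: (par _ _ _).
rewrite -par_addb -g0 -par_telescope.
pose P v := (v != (x, y)) && (v != (x + 1, y)).
have /andP[Pu Ps] : all P (u :: s).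
  by apply/allP => v vs; apply/andP; split; apply: contraTneq vs => ->.
apply: (eq_par (P := P)) kp => //.
by move=> v w /andP[? ?] /andP[? ?] kvw; rewrite crosses_horiz.
Qed.


(** A path [u :: s] from the left column [0] to the right column [M] is
    extended by one step on both sides, so that every column of [0, M] is
    crossed an odd number of times. *)
Definition ext_par (M : int) u s (v : int * int) : bool :=
  par (crosses v.1 v.2) (-1, u.2) (u :: rcons s (M + 1, (last u s).2)).

Section CrossingPath.
Variables (M : int) (u : int * int) (s : seq (int * int)).
Hypotheses (M_ge0 : 0 <= M) (kus : path king u s) (u0 : u.1 = 0)
  (lM : (last u s).1 = M)
  (box : all (fun v => [&& 0 <= v.1 <= M, 0 <= v.2 & v.2 <= M]) (u :: s)).

Let ext_path : path king (-1, u.2) (u :: rcons s (M + 1, (last u s).2)).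
Proof.
rewrite /= rcons_path kus /king /= u0 lM.
by rewrite !subrr opprD !addrA subrr !normr0 sub0r subr0 !normrN normr1 !lexx.
Qed.

Let ext_mem v : 0 <= v.1 <= M -> v \notin u :: s ->
  v \notin (-1, u.2) :: (u :: rcons s (M + 1, (last u s).2)).
Proof.
case: v => v1 v2 /= h; rewrite !inE mem_rcons !inE !xpair_eqE !negb_or.
by move=> /andP[-> ->]; rewrite andbT; lia.
Qed.

Lemma ext_par_vert x y : 0 <= x <= M -> (x, y + 1) \notin u :: s ->
  ext_par M u s (x, y) = ext_par M u s (x, y + 1).
Proof. by move=> h ?; apply: par_crosses_vert => //; exact: ext_mem. Qed.

Lemma ext_par_horiz x y : 0 <= x -> x + 1 <= M ->
  (x, y) \notin u :: s -> (x + 1, y) \notin u :: s ->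
  ext_par M u s (x, y) = ext_par M u s (x + 1, y).
Proof.
move=> x0 xM h1 h2; apply: par_crosses_horiz => //=.
- by apply: ext_mem => //=; lia.
- by apply: ext_mem => //=; lia.
- by lia.
- by rewrite last_rcons /=; lia.
Qed.

(** The parity is moved to the line between the columns -1 and 0, which only the added first step
    crosses. *)
Lemma ext_par_left y : (0, y) \notin u :: s -> ext_par M u s (0, y) = (y < u.2).
Proof.
move=> h; have u2 : y != u.2.
  by apply: contraNneq h => ->; rewrite inE -{1}u0 -surjective_pairing eqxx.
have -> : ext_par M u s (0, y) = ext_par M u s (-1, y).
  rewrite /ext_par -(addNr 1) -par_crosses_horiz ?addNr //.
  - apply/negP; rewrite !inE mem_rcons inE !xpair_eqE /=.
    case/or4P => [|/eqP E||/(mem_behead (s := u :: s)) /(allP box)] /=; try lia.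
    by move: u0; rewrite -E.
  - by apply: ext_mem => //=; lia.
  - by rewrite /= last_rcons /=; lia.
rewrite /ext_par /= par_rcons.
rewrite (eq_par (c' := fun _ _ => false) (P := fun v => 0 <= v.1)) //.
- by rewrite par_false /crosses /= u0 lM; lia.
- by move=> v w; rewrite /crosses; lia.
- by rewrite u0.
- by apply/allP => v vs; have /andP[/andP[]] := allP box _ (mem_behead (s := u :: s) vs).
Qed.

Lemma ext_par_right y : ext_par M u s (M, y) = (y < (last u s).2).
Proof.
rewrite /ext_par /= par_rcons.
rewrite (eq_par (c' := fun _ _ => false) (P := fun v => v.1 <= M)) //.
- by rewrite par_false /crosses /= u0 lM; lia.
- by move=> v w; rewrite /crosses; lia.
- by rewrite u0.
- by apply/allP => v vs; have /andP[/andP[_]] := allP box _ (mem_behead (s := u :: s) vs).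
Qed.

Lemma ext_par_top x : ext_par M u s (x, M) = false.
Proof.
rewrite /ext_par (eq_par (c' := fun _ _ => false) (P := fun v => v.2 <= M)) //.
- by rewrite par_false.
- by move=> v w; rewrite /crosses /=; lia.
- by have /and3P[] := allP box u (mem_head _ _).
- rewrite /= all_rcons /=; have /and3P[_ _ ->] := allP box u (mem_head _ _).
  have /and3P[_ _ ->] := allP box _ (mem_last u s) => /=.
  by apply/allP => v vs; have /and3P[] := allP box _ (mem_behead (s := u :: s) vs).
Qed.

(** The parity is moved down to height -1, where every crossing counts; the path leads from column
    -1 to column [M + 1]. *)
Lemma ext_par_bot x : 0 <= x <= M -> (x, 0) \notin u :: s -> ext_par M u s (x, 0).
Proof.
move=> xM h; rewrite -[0](addNr 1) -ext_par_vert ?addNr //.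
rewrite /ext_par (eq_par (c' := fun v w => (v.1 <= x) (+) (w.1 <= x))
  (P := fun v => 0 <= v.2)) //.
- by rewrite par_telescope /= last_rcons /=; lia.
- by move=> [v1 v2] [w1 w2]; rewrite /crosses /king /= !ler_norml; lia.
- by have /and3P[] := allP box u (mem_head _ _).
- rewrite /= all_rcons /=; have /and3P[_ -> _] := allP box u (mem_head _ _).
  have /and3P[_ -> _] := allP box _ (mem_last u s) => /=.
  by apply/allP => v vs; have /and3P[] := allP box _ (mem_behead (s := u :: s) vs).
Qed.

(** The move is split at [(v1, w2)] into a vertical and a horizontal one; this corner is adjacent to
    [v], hence off the path. *)
Lemma ext_par_king v w : 0 <= v.1 <= M -> 0 <= w.1 <= M -> king v w ->
  (forall z, z \in u :: s -> ~~ king v z /\ ~~ king w z) ->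
  ext_par M u s v = ext_par M u s w.
Proof.
case: v w => v1 v2 [w1 w2] /= hv hw kvw far.
have notin x y : king (x, y) (v1, v2) || king (x, y) (w1, w2) -> (x, y) \notin u :: s.
  move=> k; apply/negP => /far[/negP k1 /negP k2].
  by case/orP: k; rewrite kingC.
have [k1 k2] : `|v1 - w1| <= 1 /\ `|v2 - w2| <= 1 by apply/andP.
have vert x y y' : 0 <= x <= M -> `|y - y'| <= 1 -> (x, y) \notin u :: s ->
    (x, y') \notin u :: s -> ext_par M u s (x, y) = ext_par M u s (x, y').
  move=> hx; rewrite ler_norml => hy ny ny'.
  have [-> //|[E|E]] : y = y' \/ y = y' + 1 \/ y' = y + 1 by lia.
    by subst y; rewrite -ext_par_vert.
  by subst y'; rewrite ext_par_vert.
move: k1 k2; rewrite !ler_norml => k1 k2.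
have nv : (v1, v2) \notin u :: s by apply: notin; rewrite /king /=; lia.
have nw : (w1, w2) \notin u :: s by apply: notin; rewrite /king /=; lia.
have nm : (v1, w2) \notin u :: s by apply: notin; rewrite /king /=; lia.
rewrite (vert _ _ w2) // ?ler_norml //.
have [-> //|[E|E]] : v1 = w1 \/ v1 = w1 + 1 \/ w1 = v1 + 1 by lia.
  by subst v1; rewrite -ext_par_horiz //; lia.
by subst w1; rewrite ext_par_horiz //; lia.
Qed.

End CrossingPath.

End Parity.

(** * Disjoint connected sets in the unit square *)

Section PlanarCrossing.
Context {R : realType}.
Implicit Types (A B : set (R * R)).

Lemma floor_step (x y : R) : `|x - y| < 1 -> `|Num.floor x - Num.floor y| <= 1.
Proof.
rewrite ltr_norml => /andP[h1 h2].
have := floor_itv x; have := floor_itv y; rewrite !intrD => /andP[? ?] /andP[? ?].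
have : (Num.floor x)%:~R < (Num.floor y + 2)%:~R :> R by rewrite intrD; lra.
have : (Num.floor y)%:~R < (Num.floor x + 2)%:~R :> R by rewrite intrD; lra.
by rewrite !ltr_int ler_norml; lia.
Qed.

Lemma floor_step_dist (x y : R) : `|Num.floor x - Num.floor y| <= 1 -> `|x - y| < 2.
Proof.
rewrite ler_norml => /andP[h1 h2].
have := floor_itv x; have := floor_itv y; rewrite !intrD => /andP[? ?] /andP[? ?].
have : (Num.floor x)%:~R <= (Num.floor y + 1)%:~R :> R by rewrite ler_int; lia.
have : (Num.floor y)%:~R <= (Num.floor x + 1)%:~R :> R by rewrite ler_int; lia.
by rewrite !intrD ltr_norml; lra.
Qed.

Lemma floor_far_lt (x y : R) : ~~ (`|Num.floor x - Num.floor y| <= 1) ->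
  (Num.floor x < Num.floor y) = (x < y).
Proof.
move=> h; have [xy|yx] := ltP x y.
  have := le_floor (ltW xy); rewrite le_eqVlt => /predU1P[E|->//].
  by move: h; rewrite E subrr normr0.
by apply/negbTE; rewrite -leNgt le_floor.
Qed.

Definition unit_square : set (R * R) :=
  [set z | (0 <= z.1 <= 1) && (0 <= z.2 <= 1)].

(** [g] tells on which side of a path in [A] from [a] to [a'] a point lies. *)
Lemma crossing_side A B (a a' : R * R) :
  connected A -> compact A -> connected B -> compact B -> A `&` B = set0 ->
  A `<=` unit_square -> B `<=` unit_square ->
  A a -> a.1 = 0 -> A a' -> a'.1 = 1 ->
  exists g : R * R -> bool,
    (forall u v, B u -> B v -> g u = g v) /\
    (forall u, B u -> [/\ u.1 = 0 -> g u = (u.2 < a.2), u.1 = 1 -> g u = (u.2 < a'.2),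
                          u.2 = 1 -> g u = false & u.2 = 0 -> g u = true]).
Proof.
move=> nA cA nB cB AB0 AQ BQ Aa a0 Aa' a1.
have [e e0 he] := compact_dist cA cB AB0.
(* Points whose scaled floors are adjacent are closer than [2 / M], so this mesh keeps the grid
   images of [A] and [B] non-adjacent. *)
pose M := (Num.truncn (2 / e)).+1; have M0 : 0 < M%:R :> R by rewrite ltr0n.
have Mi : 0 < M%:R^-1 :> R by rewrite invr_gt0.
have Me : 2 / M%:R < e.
  by rewrite ltr_pdivrMr // -ltr_pdivrMl // mulrC; exact: truncnS_gt.
have floorM : Num.floor (M%:R : R) = M by rewrite pmulrn intrKfloor.
pose fl (z : R * R) := (Num.floor (M%:R * z.1), Num.floor (M%:R * z.2)).
have fl_close (x y : R * R) : within_dist M%:R^-1 x y -> king (fl x) (fl y).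
  move=> [h1 h2]; apply/andP; split; apply: floor_step;
  by rewrite -mulrBr normrM (ger0_norm (ltW M0)) mulrC -ltr_pdivlMr // div1r.
have fl_far (x y : R * R) : A x -> B y -> ~~ king (fl x) (fl y).
  move=> Ax By; apply/negP => /andP[/floor_step_dist h1 /floor_step_dist h2].
  apply: (he x y) => //; split; apply: lt_trans Me;
  by rewrite ltr_pdivlMr // mulrC -(ger0_norm (ltW M0)) -normrM mulrBr.
have fl_box z : unit_square z -> [&& 0 <= (fl z).1 <= M, 0 <= (fl z).2 & (fl z).2 <= M].
  move=> /andP[/andP[z1 z1'] /andP[z2 z2']]; rewrite /= !floor_ge0 !mulr_ge0 ?(ltW M0) //=.
  have h (t : R) : t <= 1 -> Num.floor (M%:R * t) <= M.
    move=> t1; rewrite -[leRHS]floorM; apply: le_floor.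
    by rewrite -[leRHS]mulr1 ler_wpM2l // (ltW M0).
  by rewrite !h.
(* Small steps inside the connected set [A] become a grid path from [fl a] to [fl a']. *)
have [s [kp ls sA]] : exists s, [/\ path king (fl a) s, last (fl a) s = fl a' &
    forall v, v \in fl a :: s -> exists2 z, A z & v = fl z].
  pose P z := exists s, [/\ path king (fl a) s, last (fl a) s = fl z &
    forall v, v \in fl a :: s -> exists2 z, A z & v = fl z].
  apply: (connected_step_ind (P := P) nA Mi Aa _ _ Aa').
  - exists [::]; split=> // v; rewrite inE => /eqP->; by exists a.
  - move=> x y Ax Ay /fl_close xy [s [ks ls sA]]; exists (rcons s (fl y)).
    rewrite rcons_path last_rcons ks ls xy; split=> // v.
    rewrite -rcons_cons mem_rcons inE => /predU1P[->|/sA//]; by exists y.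
have fM (x : R * R) : x.1 = 1 -> (fl x).1 = M by move=> /= ->; rewrite mulr1 floorM.
have f0 (x : R * R) : x.1 = 0 -> (fl x).1 = 0 by move=> /= ->; rewrite mulr0 floor0.
have box : all (fun v => [&& 0 <= v.1 <= Posz M, 0 <= v.2 & v.2 <= Posz M]) (fl a :: s).
  by apply/allP => v /sA[z /AQ Qz ->]; exact: fl_box.
have far v y : v \in fl a :: s -> B y -> ~~ king (fl y) v.
  by move=> /sA[z Az ->] By; rewrite kingC fl_far.
have notin y : B y -> fl y \notin fl a :: s.
  by move=> By; apply/negP => /far /(_ By); rewrite /king !subrr normr0 ler01.
have lM : (last (fl a) s).1 = M by rewrite ls fM.
have M0' : 0 <= Posz M by [].
exists (fun u => ext_par M (fl a) s (fl u)); split.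
  move=> u v Bu; apply: (connected_step_ind
    (P := fun v => ext_par M (fl a) s (fl u) = ext_par M (fl a) s (fl v)) nB Mi Bu) => //.
  move=> x y Bx By /fl_close xy ->; apply: ext_par_king => //; first exact: f0.
  - by have /andP[] := fl_box _ (BQ _ Bx).
  - by have /andP[] := fl_box _ (BQ _ By).
  - by move=> z zs; split; exact: far.
move=> u Bu; have nu := notin _ Bu; have /andP[bu _] := fl_box _ (BQ _ Bu); split=> E.
- rewrite [fl u]surjective_pairing (f0 _ E) in nu *; rewrite ext_par_left //; last exact: f0.
  have := far _ _ (mem_head _ _) Bu; rewrite /king f0 // f0 // subrr normr0 ler01 /=.
  by move=> /floor_far_lt ->; rewrite ltr_pM2l.
- rewrite [fl u]surjective_pairing (fM _ E) ext_par_right //; last exact: f0.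
  have := far _ _ (mem_last _ _) Bu; rewrite ls /king fM // fM // subrr normr0 ler01 /=.
  by move=> /floor_far_lt ->; rewrite ltr_pM2l.
- have -> : fl u = ((fl u).1, Posz M) by rewrite /fl E mulr1 floorM.
  by apply: ext_par_top => //; exact: f0.
- have E2 : fl u = ((fl u).1, 0) by rewrite /fl E mulr0 floor0.
  rewrite E2 in nu *; apply: ext_par_bot => //; exact: f0.
Qed.

End PlanarCrossing.

(** * Cells, refinements and components *)

Section Cells.
Context {R : realType}.
Implicit Types (z p q : R * R) (v w : int * int) (n : nat).

Definition cell (N : nat) v z : R * R :=
  ((z.1 + v.1%:~R) / N%:R, (z.2 + v.2%:~R) / N%:R).

Definition translate v z : R * R := (z.1 + v.1%:~R, z.2 + v.2%:~R).

Lemma translate0 z : translate 0 z = z.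
Proof. by case: z => a b; rewrite /translate /= !addr0. Qed.

Lemma translateK v z z' : z = translate v z' -> z' = translate (- v) z.
Proof. by case: z' => a b ->; rewrite /translate /= !mulrNz !addrK. Qed.

Lemma cell_eq N v w p q : (0 < N)%N ->
  cell N v p = cell N w q <-> p = translate (w - v) q.
Proof.
move=> N0; have N0' : N%:R != 0 :> R by rewrite pnatr_eq0 -lt0n.
rewrite /cell /translate [p]surjective_pairing /=; split=> -[E1 E2].
  move/(mulIf (invr_neq0 N0')): E1 => E1; move/(mulIf (invr_neq0 N0')): E2 => E2.
  by rewrite !intrB !addrA -E1 -E2 !addrK.
by rewrite E1 E2 !intrB !addrA !subrK.
Qed.

Lemma within_dist_cell N v p q (e : R) : (0 < N)%N ->
  within_dist e p q -> within_dist (e / N%:R) (cell N v p) (cell N v q).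
Proof.
move=> N0 [h1 h2]; have N0' : 0 < N%:R :> R by rewrite ltr0n.
by split=> /=; rewrite -mulrBl opprD addrACA subrr addr0 normrM
  (gtr0_norm (x := _^-1)) ?invr_gt0 // ltr_pM2r ?invr_gt0.
Qed.

Lemma continuous_cell N v : (0 < N)%N -> continuous (cell N v).
Proof.
move=> N0; apply: within_dist_continuous => e x y e0 /(within_dist_cell v N0).
apply: within_dist_le; rewrite ler_pdivrMr ?ltr0n // ler_peMr ?(ltW e0) //.
by rewrite ler1n.
Qed.

Lemma pow_small N (c e : R) : (1 < N)%N -> 0 < e -> exists n, c / N%:R ^+ n < e.
Proof.
move=> N1 e0; exists (Num.truncn (c / e)).+1.
have N0 : 0 < N%:R :> R by rewrite ltr0n ltnW.
rewrite ltr_pdivrMr ?exprn_gt0 // mulrC -ltr_pdivrMr //.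
apply: lt_trans (truncnS_gt _) _; rewrite -natrX ltr_nat; exact: ltn_expl.
Qed.

End Cells.

(** Digits are integer vectors here, so that they can be subtracted and compared with positions of
    neighbouring copies. *)
Record fractal (R : realType) (N : nat) (D : set (int * int)) (F : set (R * R)) : Prop := Fractal {
  fractal_N : (2 <= N)%N;
  fractal_fin : finite_set D;
  fractal_box : forall v, D v -> (0 <= v.1 < N) && (0 <= v.2 < N);
  fractal_neq0 : F !=set0;
  fractal_compact : compact F;
  fractal_eq : F = \bigcup_(v in D) (cell N v @` F)
}.

Section Refinement.
Context {R : realType} (N : nat) (D : set (int * int)) (F : set (R * R)).
Implicit Types (z p q : R * R) (v w : int * int) (n : nat).
Implicit Types E : R * R -> R * R -> Prop.

Definition cell_step E z z' := exists v p p',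
  [/\ D v, F p, F p', E p p' & z = cell N v p /\ z' = cell N v p'].

Definition refine_rel E := eqv_span (cell_step E).

Definition level n := iter n refine_rel (fun _ _ => True).

(** Complements of saturated sets are saturated, so this makes all unions of classes clopen in [F].
    For [same_comp] it is the form in which finiteness of the number of components is used. *)
Definition closed_classes E := forall G : set (R * R),
  (forall z z', F z -> F z' -> E z z' -> G z -> G z') -> closed (F `&` G).

Definition same_comp z z' := connected_component F z z'.

Hypothesis frac : fractal N D F.

Let N_gt0 : (0 < N)%N. Proof. exact: leq_trans (fractal_N frac). Qed.
Let N_gt0' : 0 < N%:R :> R. Proof. by rewrite ltr0n. Qed.

Lemma fractal_closed : closed F.
Proof. exact: compact_closed hausdorff_plane (fractal_compact frac). Qed.

Lemma fractal_cell v p : D v -> F p -> F (cell N v p).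
Proof. by move=> Dv Fp; rewrite (fractal_eq frac); exists v => //; exists p. Qed.

Lemma fractal_cellP z : F z -> exists v p, [/\ D v, F p & z = cell N v p].
Proof.
by rewrite {1}(fractal_eq frac) => -[v Dv [p Fp <-]]; exists v, p.
Qed.

(** A maximum of [f] is attained inside a cell, so self-similarity bounds it by
    [(max f + N - 1) / N], which forces [max f <= 1]. Used for the coordinates and for 1 minus the
    coordinates. *)
Lemma fractal_coord (f : R * R -> R) (g : int * int -> int) :
  continuous f -> (forall v z, f (cell N v z) = (f z + (g v)%:~R) / N%:R) ->
  (forall v, D v -> g v <= N%:Z - 1) -> forall z, F z -> f z <= 1.
Proof.
move=> cf fE gN.
have [c Fc cmax] := compact_EVT_max (fractal_neq0 frac) (fractal_compact frac)
  (continuous_subspaceT cf).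
move=> z Fz; apply: le_trans (cmax z (mem_set Fz)) _.
have [v [p [Dv Fp cE]]] := fractal_cellP (set_mem Fc).
have := cmax p (mem_set Fp).
have : (g v)%:~R <= (N%:Z - 1)%:~R :> R by rewrite ler_int gN.
rewrite intrB -pmulrn => hg; rewrite cE fE => hp.
have N1 : 1 < N%:R :> R by rewrite ltr1n; exact: fractal_N frac.
rewrite leNgt; apply/negP => c1.
have : f p <= (f p + (g v)%:~R) / N%:R := hp; rewrite ler_pdivlMr // => h1.
move: c1; rewrite ltr_pdivlMr // mul1r => h2.
have : (f p - 1) * (N%:R - 1) <= 0 by rewrite mulrBl !mulrBr; lra.
have : 0 < (f p - 1) * (N%:R - 1) by rewrite mulr_gt0 //; lra.
lra.
Qed.

Lemma fractal_unit : F `<=` unit_square.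
Proof.
have box v : D v -> [/\ 0 <= v.1, v.1 <= N%:Z - 1, 0 <= v.2 & v.2 <= N%:Z - 1].
  by move=> /(fractal_box frac) /andP[/andP[? ?] /andP[? ?]]; split=> //; lia.
have cf : continuous (fun z : R * R => z.1) by move=> z; exact: cvg_fst.
have cs : continuous (fun z : R * R => z.2) by move=> z; exact: cvg_snd.
move=> z Fz; apply/andP; split; apply/andP; split.
- have /= := @fractal_coord (fun z => 1 - z.1) (fun v => N%:Z - 1 - v.1) _ _ _ z Fz.
  rewrite gerBl; apply.
  + by move=> x; apply: continuousB; [exact: cvg_cst|exact: cf].
  + by move=> v p; rewrite !intrB -!pmulrn; field; rewrite gt_eqF.
  + by move=> v /box[v1 _ _ _]; lia.
- apply: (@fractal_coord (fun z => z.1) (fun v => v.1)) => // v /box[]//.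
- have /= := @fractal_coord (fun z => 1 - z.2) (fun v => N%:Z - 1 - v.2) _ _ _ z Fz.
  rewrite gerBl; apply.
  + by move=> x; apply: continuousB; [exact: cvg_cst|exact: cs].
  + by move=> v p; rewrite !intrB -!pmulrn; field; rewrite gt_eqF.
  + by move=> v /box[_ _ v1 _]; lia.
- apply: (@fractal_coord (fun z => z.2) (fun v => v.2)) => // v /box[]//.
Qed.

Lemma refine_rel_equiv E : equivalence_on (refine_rel E).
Proof. exact: eqv_span_equiv. Qed.

Lemma refine_rel_cell E v p p' : D v -> F p -> F p' -> E p p' ->
  refine_rel E (cell N v p) (cell N v p').
Proof. by move=> Dv Fp Fp' Epp'; apply: eqv_span_incl; exists v, p, p'. Qed.

Lemma refine_rel_mono E E' : (forall p p', F p -> F p' -> E p p' -> E' p p') ->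
  forall z z', refine_rel E z z' -> refine_rel E' z z'.
Proof.
move=> EE'; apply: eqv_span_mono => z z' [v [p [p' [Dv Fp Fp' Epp' zz']]]].
by exists v, p, p'; split=> //; exact: EE'.
Qed.

Lemma level_equiv n : equivalence_on (level n).
Proof. by case: n => [|n]; [split|exact: refine_rel_equiv]. Qed.

Lemma level_anti n z z' : level n.+1 z z' -> level n z z'.
Proof.
elim: n z z' => [//|n IH] z z'; apply: refine_rel_mono => p p' _ _; exact: IH.
Qed.

Lemma closed_classes_total : closed_classes (fun _ _ => True).
Proof.
move=> G GE; have [[z0 Fz0 Gz0]|nG] := pselect (exists2 z, F z & G z).
  suff -> : F `&` G = F by exact: fractal_closed.
  by apply/seteqP; split=> [z []//|z Fz]; split=> //; exact: GE Gz0.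
suff -> : F `&` G = set0 by exact: closed0.
by apply/seteqP; split=> // z [Fz Gz]; apply: nG; exists z.
Qed.

Lemma compact_of_closed_classes E G : closed_classes E ->
  (forall z z', F z -> F z' -> E z z' -> G z -> G z') -> compact (F `&` G).
Proof.
move=> cE /cE cG; apply: subclosed_compact cG (fractal_compact frac) _.
exact: subIsetl.
Qed.

(** A set saturated for the refinement is a finite union of cell images of sets saturated for [E],
    which are compact. *)
Lemma closed_classes_refine E : closed_classes E -> closed_classes (refine_rel E).
Proof.
move=> cE G GE.
have -> : F `&` G = \bigcup_(v in D) (cell N v @` (F `&` [set p | G (cell N v p)])).
  apply/seteqP; split=> [z [/fractal_cellP[v [p [Dv Fp ->]]] Gz]|_ [v Dv [p [Fp Gp] <-]]].
    by exists v => //; exists p.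
  by split=> //; exact: fractal_cell.
apply: closed_bigcup => [|v Dv]; first exact: fractal_fin frac.
apply: (compact_closed hausdorff_plane); apply: continuous_compact.
  exact/continuous_subspaceT/continuous_cell.
apply: (compact_of_closed_classes cE) => p p' Fp Fp' Epp' /=.
by apply: GE; [exact: fractal_cell..|exact: refine_rel_cell].
Qed.

Lemma closed_classes_level n : closed_classes (level n).
Proof. by elim: n => [|n IH]; [exact: closed_classes_total|exact: closed_classes_refine]. Qed.

Lemma same_comp_equiv_in : [/\ forall z, F z -> same_comp z z,
  forall z z', same_comp z z' -> same_comp z' z &
  forall y x z, same_comp x y -> same_comp y z -> same_comp x z].
Proof.
split; [exact: connected_component_refl|exact: connected_component_sym|].
by move=> y x z; exact: connected_component_trans.
Qed.

Lemma same_comp_in z z' : same_comp z z' -> F z /\ F z'.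
Proof.
by move=> h; split; apply: connected_component_sub; [exact: connected_component_sym h|exact: h].
Qed.

Lemma same_comp_sub E : equivalence_on E -> closed_classes E ->
  forall z z', same_comp z z' -> E z z'.
Proof.
move=> [rE sE tE] cE z z' zz'; have [Fz Fz'] := same_comp_in zz'.
apply: (connected_sub_clopen (A := connected_component F z) (B := F) (G := E z)
  _ _ _ _ _ _ zz') => //.
- exact: component_connected.
- exact: connected_component_sub.
- by apply: cE => x y _ _ xy zx; exact: tE zx xy.
- by apply: cE => x y _ _ xy nzx zy; apply: nzx; exact: tE zy (sE _ _ xy).
- exact: connected_component_refl.
Qed.

Lemma same_comp_level n z z' : same_comp z z' -> level n z z'.
Proof. apply: same_comp_sub; [exact: level_equiv|exact: closed_classes_level]. Qed.

Lemma same_comp_cell v p p' : D v -> same_comp p p' ->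
  same_comp (cell N v p) (cell N v p').
Proof.
move=> Dv pp'; have [Fp Fp'] := same_comp_in pp'.
apply: (connected_component_max (B := cell N v @` connected_component F p)).
- by exists p => //; exact: connected_component_refl.
- by move=> _ [q /connected_component_sub Fq <-]; exact: fractal_cell.
- apply: connected_continuous_connected; first exact: component_connected.
  exact/continuous_subspaceT/continuous_cell.
- by exists p'.
Qed.

Lemma unit_square_dist z z' : F z -> F z' -> within_dist 2 z z'.
Proof.
move=> /fractal_unit /andP[/andP[? ?] /andP[? ?]] /fractal_unit /andP[/andP[? ?] /andP[? ?]].
by split; rewrite ltr_norml; lra.
Qed.

(** Each refinement replaces a link by a chain copied into a cell, which divides the step length by
    [N]. *)
Lemma refine_fixed_chain E :
  (forall z z', F z -> F z' -> E z z' -> refine_rel E z z') ->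
  (forall z z', refine_rel E z z' -> E z z') ->
  forall n z z', F z -> F z' -> E z z' ->
  eqv_span (fun u u' => [/\ F u, F u', E u u' & within_dist (2 / N%:R ^+ n) u u']) z z'.
Proof.
move=> ER RE; elim=> [|n IH] z z' Fz Fz' zz'.
  apply: eqv_span_incl; split=> //; rewrite expr0 divr1; exact: unit_square_dist.
move: (ER _ _ Fz Fz' zz'); apply: eqv_span_min; first exact: eqv_span_equiv.
move=> _ _ [v [p [p' [Dv Fp Fp' Epp' [-> ->]]]]].
move: (IH _ _ Fp Fp' Epp'); move: p p' {Fp Fp' Epp'}.
apply: eqv_span_min; first exact/equivalence_on_preim/eqv_span_equiv.
move=> p p' [Fp Fp' pp' dpp']; apply: eqv_span_incl; split; try exact: fractal_cell.
  by apply: RE; exact: refine_rel_cell.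
by rewrite exprSr invfM mulrA; exact: within_dist_cell.
Qed.

(** A clopen part of a class and the rest of the class are compact, hence at positive distance if
    both are non-empty; the chains of [refine_fixed_chain] have shorter steps. *)
Lemma refine_fixed_same_comp E : equivalence_on E -> closed_classes E ->
  (forall z z', F z -> F z' -> E z z' -> refine_rel E z z') ->
  (forall z z', refine_rel E z z' -> E z z') ->
  forall z z', F z -> F z' -> E z z' -> same_comp z z'.
Proof.
move=> [rE sE tE] cE ER RE z z' Fz Fz' zz'.
pose K := F `&` E z.
have satK x y : F x -> F y -> E x y -> E z x -> E z y by move=> _ _ xy zx; exact: tE zx xy.
have cK : compact K := compact_of_closed_classes cE satK.
apply: (connected_component_max (B := K)) => //; first exact: subIsetl.
move=> B [b Bb] [U oU BU] [C cC BC].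
have cptB : compact B by rewrite BC; exact: compact_closedI.
have cptB' : compact (K `&` ~` U) by apply: compact_closedI => //; rewrite closedC.
have [e e0 he] : exists2 e, 0 < e & forall x y, B x -> (K `&` ~` U) y -> ~ within_dist e x y.
  apply: compact_dist => //; apply/seteqP; split=> // x [].
  by rewrite BU => -[_ Ux] [].
have [n /ltW hn] := pow_small 2 (fractal_N frac) e0.
apply/seteqP; split=> [x|y [Fy zy]]; first by rewrite BU => -[].
have [Fb zb] : K b by move: Bb; rewrite BU => -[].
have Eby : E b y by exact: tE (sE _ _ zb) zy.
have link x x' : F x -> F x' -> E x x' -> within_dist (2 / N%:R ^+ n) x x' -> B x -> B x'.
  move=> Fx Fx' xx' dxx' Bx; apply: contrapT => nBx'; apply: (he x x') => //.
    have [_ zx] : K x by move: Bx; rewrite BU => -[].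
    have Kx' : K x' by split=> //; exact: satK xx' zx.
    by split=> // Ux'; apply: nBx'; rewrite BU.
  exact: within_dist_le dxx'.
have key x x' : [/\ F x, F x', E x x' & within_dist (2 / N%:R ^+ n) x x'] -> (B x <-> B x').
  move=> [Fx Fx' xx' dxx']; split; first exact: link.
  apply: link => //; [exact: sE|exact: within_dist_sym].
have [+ _] := eqv_span_min (equivalence_on_iff B) key
  (@refine_fixed_chain E ER RE n b y Fb Fy Eby).
by apply.
Qed.

End Refinement.

(** * Contacts and isolated components *)

Section SideCoordinates.
Implicit Types (v w e : int * int).

(** [b] selects the axis ([true] is horizontal) and [s] its orientation, so that the four sides of
    the square are treated at once. *)
Definition side_coord (b s : bool) (e : int * int) : int :=
  let c := if b then e.1 else e.2 in if s then c else - c.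

Lemma side_coordD b s v w : side_coord b s (v + w) = side_coord b s v + side_coord b s w.
Proof. by case: b s => -[] //=; rewrite /side_coord /= opprD. Qed.

Lemma side_coordN b s v : side_coord b s (- v) = - side_coord b s v.
Proof. by case: b s => -[]. Qed.

Lemma side_coord_le1 b s e : (`|e.1| <= 1) && (`|e.2| <= 1) -> -1 <= side_coord b s e <= 1.
Proof.
by move=> /andP[]; rewrite !ler_norml /side_coord; case: b; case: s => /=; lia.
Qed.

Lemma side_coord_eq0 b s1 s2 e :
  side_coord b s1 e = 0 -> side_coord (~~ b) s2 e = 0 -> e = 0.
Proof.
by rewrite [e]surjective_pairing /side_coord; case: b; case: s1; case: s2 => /= h1 h2;
  congr pair; lia.
Qed.

Lemma side_coord_negb b s e : side_coord b (~~ s) e = - side_coord b s e.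
Proof. by rewrite /side_coord; case: s => //=; rewrite opprK. Qed.

End SideCoordinates.

Section FiniteComponents.
Context {R : realType} (N : nat) (D : set (int * int)) (F : set (R * R)).
Implicit Types (z p q : R * R) (v w d : int * int) (n : nat).

Hypothesis frac : fractal N D F.
Hypothesis clopen_comp : closed_classes F (same_comp F).
Hypothesis disc : exists z z', [/\ F z, F z' & ~ same_comp F z z'].

Let N_gt1 : (1 < N)%N. Proof. exact: fractal_N frac. Qed.
Let N_gt0 : (0 < N)%N. Proof. exact: ltnW. Qed.

Local Notation "z ~~ z'" := (same_comp F z z') (at level 70).

Lemma comp_refl z : F z -> z ~~ z.
Proof. by have [h _ _] := same_comp_equiv_in F; apply: h. Qed.

Lemma comp_sym z z' : z ~~ z' -> z' ~~ z.
Proof. by have [_ h _] := same_comp_equiv_in F; apply: h. Qed.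

Lemma comp_trans z' z z'' : z ~~ z' -> z' ~~ z'' -> z ~~ z''.
Proof. by have [_ _ h] := same_comp_equiv_in F; apply: h. Qed.

Lemma comp_other p : F p -> exists2 q, F q & ~ p ~~ q.
Proof.
move=> Fp; have [z [z' [Fz Fz' nzz']]] := disc.
have [pz|npz] := pselect (p ~~ z); last by exists z.
by exists z' => // pz'; apply: nzz'; apply: comp_trans pz'; exact: comp_sym.
Qed.

(** The refinement of [same_comp] has closed classes as well, so it contains [same_comp]: a
    component is a chain of copies of components in cells. *)
Lemma same_comp_ind (W : set (R * R)) :
  (forall v p p', D v -> p ~~ p' -> W (cell N v p) -> W (cell N v p')) ->
  forall z z', z ~~ z' -> W z -> W z'.
Proof.
move=> hW z z' zz'; apply: proj1; move: zz'.
move=> /(same_comp_sub (refine_rel_equiv N D F _) (closed_classes_refine frac clopen_comp)).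
move: z z'; apply: (eqv_span_min (equivalence_on_iff W)).
move=> _ _ [v [p [p' [Dv Fp Fp' pp' [-> ->]]]]].
by split; apply: hW => //; exact: comp_sym.
Qed.

Definition contact p (e : int * int) := exists2 q, F q & p = translate e q.

Lemma contact_range p e : F p -> contact p e -> (`|e.1| <= 1) && (`|e.2| <= 1).
Proof.
move=> Fp [q Fq pE].
have /andP[/andP[p1 p2] /andP[p3 p4]] := fractal_unit frac Fp.
have /andP[/andP[q1 q2] /andP[q3 q4]] := fractal_unit frac Fq.
have e1 : e.1%:~R = p.1 - q.1 by rewrite pE /translate /= addrAC subrr add0r.
have e2 : e.2%:~R = p.2 - q.2 by rewrite pE /translate /= addrAC subrr add0r.
by rewrite -!(ler_int R) !intr_norm e1 e2 !ler_norml; apply/andP; split; lra.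
Qed.

Definition dilate (e : int * int) : int * int := (N%:Z * e.1, N%:Z * e.2).

(** The copy of [F] at [e] consists of cells; seen from cell [d], its cell [v] lies at
    [v - d + dilate e]. *)
Lemma contact_cell d p e : contact (cell N d p) e ->
  exists2 v, D v & contact p (v - d + dilate e).
Proof.
move=> [_ /(fractal_cellP frac)[v [q [Dv Fq ->]]] E]; exists v => //.
have N0 : N%:R != 0 :> R by rewrite pnatr_eq0 -lt0n.
exists q => //; rewrite addrAC; apply/(cell_eq d (v + dilate e) p q N_gt0); rewrite E.
by rewrite /cell /translate /= !intrD !intrM -!pmulrn; congr pair; field.
Qed.

(** No contact leads to another digit, so the copy of the component of [p] in cell [d] is closed
    under the links of [same_comp_ind]. *)
Lemma isolated_cell d p : D d -> F p ->
  (forall p' e, p ~~ p' -> contact p' e -> e != 0 -> ~ D (d + e)) ->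
  forall z, cell N d p ~~ z -> exists2 p', p ~~ p' & z = cell N d p'.
Proof.
move=> Dd Fp iso z dz.
apply: (same_comp_ind (W := [set z | exists2 p', p ~~ p' & z = cell N d p']) _ dz) => /=;
  last by exists p => //; exact: comp_refl.
move=> v q q' Dv qq' [p' pp' E]; have [Fq Fq'] := same_comp_in qq'.
have := E; move/esym; move/(cell_eq d v p' q N_gt0).
have [vd|nvd] := eqVneq v d.
  subst v; rewrite subrr translate0 => Ep; subst p'; exists q' => //; exact: comp_trans qq'.
move=> Ep; exfalso; apply: (iso p' (v - d)) => //; last by rewrite addrC subrK.
  by exists q.
by rewrite subr_eq0.
Qed.

(** The fixed point of the cell map lies in [F], and its component, being clopen, contains all
    points of [F] near it. The iterates shrink all of [F] towards this point. *)
Lemma cell_contracts d : D d -> exists n, forall p q, F p -> F q ->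
  iter n (cell N d) p ~~ iter n (cell N d) q.
Proof.
move=> Dd; pose b : R * R := (d.1%:~R / (N%:R - 1), d.2%:~R / (N%:R - 1)).
have N1 : 1 < N%:R :> R by rewrite ltr1n.
have N0 : N%:R != 0 :> R by rewrite pnatr_eq0 -lt0n.
have bE : cell N d b = b.
  rewrite /cell /b /=; have N1' : N%:R - 1 != 0 :> R by rewrite subr_eq0 gt_eqF.
  by congr pair; field; rewrite N0 N1'.
clearbody b.
have Fiter n p : F p -> F (iter n (cell N d) p).
  by move=> Fp; elim: n => //= n IH; apply: (fractal_cell frac Dd IH).
have contr n p (e : R) : within_dist e b p -> within_dist (e / N%:R ^+ n) b (iter n (cell N d) p).
  move=> h; elim: n => [|n IH] /=; first by rewrite expr0 divr1.
  by rewrite exprSr invfM mulrA -bE; exact: within_dist_cell.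
have [r r0 hr] : exists2 r, 0 < r & forall p, F p -> within_dist r b p.
  exists (`|b.1| + `|b.2| + 2) => [|p /(fractal_unit frac) /andP[/andP[p1 p2] /andP[p3 p4]]].
    by rewrite ltr_wpDl // addr_ge0.
  have b1 := normr_ge0 b.1; have b2 := normr_ge0 b.2.
  have [a1 a2] : p.1 <= 1 /\ p.2 <= 1 by [].
  by split; rewrite (le_lt_trans (ler_normB _ _)) // ?(ger0_norm p1) ?(ger0_norm p3); lra.
have conv (e : R) : 0 < e -> exists n, forall p, F p -> within_dist e b (iter n (cell N d) p).
  move=> e0; have [n hn] := pow_small r N_gt1 e0; exists n => p Fp.
  by apply: within_dist_le (ltW hn) _; apply/contr/hr.
have Fb : F b.
  apply: closed_approx => [|e e0]; first exact: fractal_closed frac.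
  have [n hn] := conv e e0; have [p Fp] := fractal_neq0 frac.
  by exists (iter n (cell N d) p); [exact: Fiter|exact: hn].
suff [n hn] : exists n, forall p, F p -> b ~~ iter n (cell N d) p.
  by exists n => p q Fp Fq; apply: comp_trans (hn q Fq); exact/comp_sym/hn.
have cK : closed (F `&` ~` [set q | b ~~ q]).
  apply: clopen_comp => z z' _ _ zz' /= nbz bz'; apply: nbz.
  exact: comp_trans (comp_sym zz').
have [e e0 he] : exists2 e, 0 < e & forall y, within_dist e b y -> F y -> b ~~ y.
  apply: contrapT => /forall2NP nh.
  have [] // : (F `&` ~` [set q | b ~~ q]) b; last by move=> _ /(_ (comp_refl Fb)).
  apply: closed_approx => // e e0; case: (nh e) => // /existsNP[y].
  by move=> /not_implyP[by1 /not_implyP[Fy nby]]; exists y.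
by have [n hn] := conv e e0; exists n => p Fp; apply: he; [exact: hn|exact: Fiter].
Qed.

Lemma cell_inj d : injective (cell N d : R * R -> R * R).
Proof. by move=> p q /(cell_eq d d p q N_gt0); rewrite subrr translate0. Qed.

Lemma dilate_eq0 v d e : D v -> D d -> v - d + dilate e = 0 -> e = 0.
Proof.
have mul_small (a c : int) : - N%:Z < a < N -> a + N%:Z * c = 0 -> c = 0.
  move=> aN E; have : ~ (1 <= c) by nia.
  have : ~ (c <= -1) by nia.
  by lia.
move=> /(fractal_box frac)/andP[/andP[? ?] /andP[? ?]].
move=> /(fractal_box frac)/andP[/andP[? ?] /andP[? ?]].
move=> /[dup] /(congr1 fst) /= E1 /(congr1 snd) /= E2.
rewrite [e]surjective_pairing; congr pair.
  by apply: (mul_small (v.1 - d.1)) => //; lia.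
by apply: (mul_small (v.2 - d.2)) => //; lia.
Qed.

(** Iterating an isolated cell would produce arbitrarily small components. *)
Lemma no_persistent_isolation (B : int * int -> Prop) d p : D d -> F p ->
  (forall e, B e -> ~ D (d + e)) ->
  (forall v e, D v -> e != 0 -> (`|e.1| <= 1) && (`|e.2| <= 1) ->
     B (v - d + dilate e) -> B e) ->
  ~ (forall p' e, p ~~ p' -> contact p' e -> e != 0 -> B e).
Proof.
move=> Dd Fp iso persist Bp.
have Fiter n q : F q -> F (iter n (cell N d) q).
  by move=> Fq; elim: n => //= n IH; apply: (fractal_cell frac Dd IH).
(* Along the iteration the component stays inside the iterated image of the component of [p], and
   its contacts still satisfy [B]. *)
have step n : (forall z, iter n (cell N d) p ~~ z ->
      exists2 p', p ~~ p' & z = iter n (cell N d) p') /\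
    (forall z e, iter n (cell N d) p ~~ z -> contact z e -> e != 0 -> B e).
  elim: n => [|n [IH1 IH2]] /=; first by split=> // z pz; exists z.
  have isol : forall z, cell N d (iter n (cell N d) p) ~~ z ->
      exists2 p', iter n (cell N d) p ~~ p' & z = cell N d p'.
    apply: isolated_cell => //; first exact: Fiter.
    by move=> p' e pp' ce e0; apply/iso/(IH2 p').
  split=> [z /isol[p' /IH1[q pq ->] ->]|z e /isol[p' pp' ->] ce e0]; first by exists q.
  have [v Dv cv] := contact_cell ce; have [_ Fp'] := same_comp_in pp'.
  apply: (persist v) => //.
    exact: contact_range (fractal_cell frac Dd Fp') ce.
  apply: (IH2 p') => //; apply: contra_neq e0 => E; exact: dilate_eq0 Dv Dd E.
(* For large [n] the iterates of [p] and of a point [q] of another component share a component;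
   injectivity then puts [q] into the component of [p]. *)
have [n hn] := cell_contracts Dd; have [q Fq npq] := comp_other Fp.
have [q' pq' E] := (step n).1 _ (hn p q Fp Fq).
have inj : injective (iter n (cell N d) : R * R -> R * R).
  by elim: (n) => [|m IH] x y //= /cell_inj /IH.
by apply: npq; rewrite (inj _ _ E).
Qed.

Lemma side_coord_dilate b s v : side_coord b s (dilate v) = N%:Z * side_coord b s v.
Proof. by case: b s => -[] //=; rewrite /side_coord /dilate /= mulrN. Qed.

Definition side_coordE := (side_coordD, side_coordN, side_coord_dilate).

Lemma side_coord_box b s v w : D v -> D w -> side_coord b s v - side_coord b s w <= N%:Z - 1.
Proof.
move=> /(fractal_box frac)/andP[/andP[? ?] /andP[? ?]].
move=> /(fractal_box frac)/andP[/andP[? ?] /andP[? ?]].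
by case: b s => -[]; rewrite /side_coord /=; lia.
Qed.

Lemma fractal_digits_neq0 : D !=set0.
Proof.
have [z Fz] := fractal_neq0 frac; have [v [_ [Dv _ _]]] := fractal_cellP frac Fz.
by exists v.
Qed.

Lemma digit_argmin (D' : set (int * int)) b s : D' !=set0 -> D' `<=` D ->
  exists2 d, D' d & forall v, D' v -> side_coord b s d <= side_coord b s v.
Proof.
move=> [w Dw] D'D.
(* Adding [N] makes the coordinate nonnegative, so that a minimum over the natural numbers
   exists. *)
pose f v := absz (side_coord b s v + N%:Z).
have [|n /asboolP[d Dd <-] dmin] := @ex_minnP (fun n => `[< exists2 v, D' v & f v = n >]).
  by exists (f w); apply/asboolP; exists w.
exists d => // v Dv.
have /dmin : `[< exists2 w, D' w & f w = f v >] by apply/asboolP; exists v.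
have pos u : D' u -> 0 <= side_coord b s u + N%:Z.
  move=> /D'D /(fractal_box frac)/andP[/andP[? ?] /andP[? ?]].
  by rewrite /side_coord; case: (b); case: (s); lia.
by rewrite /f; have := pos _ Dv; have := pos _ Dd; lia.
Qed.

(** The cell of a digit minimal along this axis has no neighbour on the side of the contacts, and
    this persists under iteration. *)
Lemma no_one_sided_contact b s p : F p ->
  ~ (forall p' e, p ~~ p' -> contact p' e -> e != 0 -> side_coord b s e = -1).
Proof.
have [d Dd dmin] := digit_argmin b s fractal_digits_neq0 (@subset_refl _ _).
move=> Fp; apply: (no_persistent_isolation (d := d)) => //.
  by move=> e he /dmin; rewrite side_coordD he; lia.
move=> v e Dv e0 er; rewrite !side_coordE => he.
have := dmin v Dv.
have := side_coord_le1 b s er.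
by move: he; move: (side_coord b s e) (side_coord b s v) (side_coord b s d); nia.
Qed.

(** Otherwise let [d] minimise [l2] and then [l1]. If [d] minimises [l1] among all digits, both
    sides with value -1 are free and stay so under iteration. If not, cell [d] is still isolated,
    and its component has only contacts with [l2] equal to -1, against [no_one_sided_contact]. *)
Lemma corner_contact b s1 s2 p : F p ->
  (forall p' e, p ~~ p' -> contact p' e -> e != 0 ->
     side_coord b s1 e = -1 \/ side_coord (~~ b) s2 e = -1) ->
  exists p' e, [/\ p ~~ p', contact p' e, side_coord b s1 e = -1 & side_coord (~~ b) s2 e = 1].
Proof.
move=> Fp; set l1 := side_coord b s1; set l2 := side_coord (~~ b) s2 => H.
apply: contrapT => nstar.
have star p' e : p ~~ p' -> contact p' e -> l1 e = -1 -> l2 e <> 1.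
  by move=> pp' ce h1 h2; apply: nstar; exists p', e.
have range p' e : p ~~ p' -> contact p' e -> -1 <= l1 e <= 1 /\ -1 <= l2 e <= 1.
  move=> pp'; have [_ Fp'] := same_comp_in pp'.
  by move=> /(contact_range Fp') er; split; exact: side_coord_le1.
have [d0 Dd0 d0min] := digit_argmin (~~ b) s2 fractal_digits_neq0 (@subset_refl _ _).
have [|d [Dd dd0] dmin] := @digit_argmin (D `&` [set v | l2 v = l2 d0]) b s1 _ (@subIsetl _ _ _).
  by exists d0.
have {}d0min v : D v -> l2 d <= l2 v by rewrite dd0; exact: d0min.
have {}dmin v : D v -> l2 v = l2 d -> l1 d <= l1 v by move=> Dv; rewrite dd0 => vd; exact: dmin.
have [d1min|/existsNP[w /not_implyP[Dw /negP]]] := pselect (forall v, D v -> l1 d <= l1 v).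
  apply: (no_persistent_isolation (B := fun e => l1 e = -1 \/ l2 e = -1) Dd Fp) H.
    by move=> e he Dde; have := d1min _ Dde; have := d0min _ Dde;
      rewrite /l1 /l2 !side_coordD -/l1 -/l2; lia.
  move=> v e Dv e0 er; rewrite /l1 /l2 !side_coordE -/l1 -/l2 => he.
  have := side_coord_le1 b s1 er; have := side_coord_le1 (~~ b) s2 er.
  rewrite -/l1 -/l2; have := d1min v Dv; have := d0min v Dv; move: he.
  by move: (l1 e) (l2 e) (l1 v) (l2 v) (l1 d) (l2 d); nia.
rewrite -ltNge => l1w.
have iso p' e : p ~~ p' -> contact p' e -> e != 0 -> ~ D (d + e).
  move=> pp' ce e0 Dde; have := d0min _ Dde; have := dmin _ Dde.
  have := H _ _ pp' ce e0; have := star _ _ pp' ce; have := range _ _ pp' ce.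
  by rewrite /l1 /l2 !side_coordD -/l1 -/l2; lia.
apply: (@no_one_sided_contact (~~ b) s2 (cell N d p) (fractal_cell frac Dd Fp)).
move=> z e /(isolated_cell Dd Fp iso)[p' pp' ->] ce e0; rewrite -/l2.
have [v Dv cv] := contact_cell ce; have [_ Fp'] := same_comp_in pp'.
have er := contact_range (fractal_cell frac Dd Fp') ce.
have f0 : v - d + dilate e != 0.
  by apply: contra_neq e0 => E; exact: dilate_eq0 Dv Dd E.
have := H _ _ pp' cv f0; have := star _ _ pp' cv; have := range _ _ pp' cv.
rewrite /l1 /l2 !side_coordE -/l1 -/l2.
have := side_coord_le1 b s1 er; have := side_coord_le1 (~~ b) s2 er; rewrite -/l1 -/l2.
(* A contact with [l2 e = 0] would need a digit [v] lying [N - 1] beyond [d] along [l1]; the digit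
   [w] before [d] leaves no room for it. *)
have := side_coord_box b s1 Dv Dw; rewrite -/l1.
have := d0min v Dv; have := dmin v Dv.
have e00 : l1 e = 0 -> l2 e <> 0.
  by move=> h1 h2; move: e0; rewrite (side_coord_eq0 h1 h2) eqxx.
move: e00 l1w; move: (l1 e) (l2 e) (l1 v) (l2 v) (l1 d) (l2 d) (l1 w).
move=> a1 a2 v1 v2 d1 d2 w1 a00 wd dm d0m box r2 r1 [r3 r4] st hh.
have [//|h2] := eqVneq a2 (-1).
have a20 : a2 = 0.
  have : ~ (a2 = 1) by move=> a21; subst a2; lia.
  by lia.
subst a2; have h1 : v1 - d1 + N%:Z * a1 = -1 by lia.
have vd : v2 = d2 by lia.
have := dm vd; have [E|[E|E]] : a1 = -1 \/ a1 = 0 \/ a1 = 1 by lia.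
- by subst a1; lia.
- by case: a00.
- by subst a1; lia.
Qed.

(** * Sides of the square touched by a component *)

Definition touches p b s := exists2 p', p ~~ p' &
  (if b then p'.1 else p'.2) = (if s then 1 else 0).

Lemma contact_touches b s p e : F p -> contact p e -> side_coord b s e = 1 ->
  (if b then p.1 else p.2) = (if s then 1 else 0).
Proof.
move=> Fp [q Fq pE]; move: (fractal_unit frac Fp) (fractal_unit frac Fq).
rewrite pE /translate /side_coord /unit_square /= => /andP[/andP[? ?] /andP[? ?]].
move=> /andP[/andP[? ?] /andP[? ?]].
case: b; case: s => /= E.
- have E' : e.1%:~R = 1 :> R by rewrite E.
  by lra.
- have E' : e.1%:~R = -1 :> R by rewrite -[e.1]opprK E.
  by lra.
- have E' : e.2%:~R = 1 :> R by rewrite E.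
  by lra.
- have E' : e.2%:~R = -1 :> R by rewrite -[e.2]opprK E.
  by lra.
Qed.

Lemma touches_comp p q b s : p ~~ q -> touches p b s -> touches q b s.
Proof.
by move=> pq [p' pp' h]; exists p' => //; apply: comp_trans pp'; exact: comp_sym.
Qed.

(** Without such a contact, [corner_contact] applies to both orders of the axes and yields contacts
    at two opposite corners, which together touch all four sides. *)
Lemma inner_contact s1 s2 p : F p ->
  (exists p' e, [/\ p ~~ p', contact p' e, e != 0,
     0 <= side_coord true s1 e & 0 <= side_coord false s2 e]) \/
  (forall b s, touches p b s).
Proof.
move=> Fp; apply: contrapT => /not_orP[nin nt]; apply: nt.
have H p' e : p ~~ p' -> contact p' e -> e != 0 ->
    side_coord true s1 e = -1 \/ side_coord false s2 e = -1.
  move=> pp' ce e0; have [_ Fp'] := same_comp_in pp'; have er := contact_range Fp' ce.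
  have := side_coord_le1 true s1 er; have := side_coord_le1 false s2 er.
  have [h1|h1] := ltP (side_coord true s1 e) 0; first by lia.
  have [h2|h2] := ltP (side_coord false s2 e) 0; first by lia.
  by exfalso; apply: nin; exists p', e.
have [p1 [e1 [pp1 c1 h1 h1']]] := corner_contact Fp H.
have [|p2 [e2 [pp2 c2 h2 h2']]] := @corner_contact false s2 s1 p Fp.
  by move=> p' e pp' ce e0; rewrite or_comm; exact: H ce e0.
have [_ Fp1] := same_comp_in pp1; have [_ Fp2] := same_comp_in pp2.
have E1 : side_coord true (~~ s1) e1 = 1 by rewrite side_coord_negb h1.
have E2 : side_coord false (~~ s2) e2 = 1 by rewrite side_coord_negb h2.
move=> b s; case: b.
  have [->|ne] := eqVneq s s1.
    by exists p2 => //; exact: (contact_touches Fp2 c2 h2').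
  have -> : s = ~~ s1 by move: ne; case: (s); case: (s1).
  by exists p1 => //; exact: (contact_touches Fp1 c1 E1).
have [->|ne] := eqVneq s s2.
  by exists p1 => //; exact: (contact_touches Fp1 c1 h1').
have -> : s = ~~ s2 by move: ne; case: (s); case: (s2).
by exists p2 => //; exact: (contact_touches Fp2 c2 E2).
Qed.

Definition spans p b := touches p b false /\ touches p b true.

(** For each choice of a vertical and a horizontal side, [inner_contact] shows that one of the two
    is touched; the four choices together leave only the two alternatives. *)
Lemma comp_spans p : F p -> spans p true \/ spans p false.
Proof.
move=> Fp.
have dir s1 s2 : touches p true s1 \/ touches p false s2.
  have [[p' [e [pp' ce e0 h1 h2]]]|h] := inner_contact s1 s2 Fp; last by left.
  have [_ Fp'] := same_comp_in pp'; have er := contact_range Fp' ce.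
  have r1 := side_coord_le1 true s1 er; have r2 := side_coord_le1 false s2 er.
  have [E|E] : side_coord true s1 e = 1 \/ side_coord false s2 e = 1.
    have : side_coord true s1 e = 0 -> side_coord false s2 e <> 0.
      by move=> z1 z2; move: e0; rewrite (@side_coord_eq0 true s1 s2 e z1 z2) eqxx.
    by lia.
  - by left; exists p' => //; exact: (contact_touches Fp' ce E).
  - by right; exists p' => //; exact: (contact_touches Fp' ce E).
have := (dir true true, dir true false, dir false true, dir false false).
rewrite /spans; tauto.
Qed.

Lemma comp_side p q a a' : ~ p ~~ q -> p ~~ a -> a.1 = 0 -> p ~~ a' -> a'.1 = 1 ->
  exists g : R * R -> bool,
    (forall u u', q ~~ u -> q ~~ u' -> g u = g u') /\
    (forall u, q ~~ u -> [/\ u.1 = 0 -> g u = (u.2 < a.2), u.1 = 1 -> g u = (u.2 < a'.2),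
                          u.2 = 1 -> g u = false & u.2 = 0 -> g u = true]).
Proof.
move=> npq pa a0 pa' a1.
have compc z : compact (connected_component F z).
  apply: subclosed_compact (fractal_compact frac) (@connected_component_sub _ _ _).
  exact: component_closed (fractal_closed frac).
apply: (@crossing_side _ (connected_component F p) (connected_component F q) a a') => //;
  try exact: component_connected; try exact: compc.
- apply/seteqP; split=> // z [pz qz]; apply: npq.
  exact: comp_trans pz (comp_sym qz).
- by move=> z /connected_component_sub; exact: (fractal_unit frac).
- by move=> z /connected_component_sub; exact: (fractal_unit frac).
Qed.

(** If the components differed, a top-to-bottom one would lie on both sides of a left-to-right
    one. *)
Lemma spans_comp p q : F p -> F q -> spans p true -> spans q false -> p ~~ q.
Proof.
move=> Fp Fq [[a pa a0] [a' pa' a1]] [[b qb b0] [b' qb' b1]]; apply: contrapT => npq.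
have [g [gc gv]] := comp_side npq pa a0 pa' a1.
have [_ _ _ /(_ b0)] := gv _ qb; have [_ _ /(_ b1) + _] := gv _ qb'.
by rewrite (gc _ _ qb qb') => ->.
Qed.

(** A component that joins top and bottom would coincide with every component that joins left and
    right, leaving only one component. *)
Lemma spans_alternative : (exists2 p, F p & spans p true) -> forall q, F q -> spans q true /\ ~ spans q false.
Proof.
move=> [p Fp sp].
have all q : F q -> spans q true.
  move=> Fq; have [//|sq] := comp_spans Fq.
  have pq := spans_comp Fp Fq sp sq.
  by case: sp => *; split; apply: touches_comp pq _.
move=> q Fq; split; first exact: all.
move=> sq; have [r Fr nqr] := comp_other Fq; apply: nqr.
by apply: comp_sym; apply: spans_comp sq => //; exact: all.
Qed.

End FiniteComponents.

(** * Horizontal strands *)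

Section Strands.
Context {R : realType} (N : nat) (D : set (int * int)) (F : set (R * R)).
Implicit Types (z p q : R * R) (v w d : int * int) (n : nat).

Hypothesis frac : fractal N D F.
Hypothesis clopen_comp : closed_classes F (same_comp F).
Hypothesis disc : exists z z', [/\ F z, F z' & ~ same_comp F z z'].
Hypothesis horizontal : forall p, F p -> spans F p true /\ ~ spans F p false.

Local Notation "z ~~ z'" := (same_comp F z z') (at level 70).
Local Notation contact := (contact F).

Lemma left_point p : F p -> exists2 a, p ~~ a & a.1 = 0.
Proof. by move=> /horizontal[[h _] _]. Qed.

Lemma right_point p : F p -> exists2 a, p ~~ a & a.1 = 1.
Proof. by move=> /horizontal[[_ h] _]. Qed.

(** The component misses the top or the bottom. [inner_contact] is applied towards the missed side,
    where a vertical part of the contact is impossible. *)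
Lemma horizontal_contact s p : F p ->
  exists2 p', p ~~ p' & contact p' (if s then 1 else -1, 0).
Proof.
move=> Fp; have [_ nsp] := horizontal Fp.
have [s2 nt] : exists s2, ~ touches F p false s2.
  apply: contrapT => h; apply: nsp; split; apply: contrapT => n; apply: h.
    by exists false.
  by exists true.
have [[p' [e [pp' ce e0 h1 h2]]]|h] := inner_contact frac clopen_comp disc s s2 Fp;
  last by case: (nt (h _ _)).
have [_ Fp'] := same_comp_in pp'; have er := contact_range frac Fp' ce.
have r1 := side_coord_le1 true s er; have r2 := side_coord_le1 false s2 er.
have n2 : side_coord false s2 e <> 1.
  by move=> h; apply: nt; exists p' => //; exact: (contact_touches frac Fp' ce h).
have E2 : side_coord false s2 e = 0 by lia.
have E1 : side_coord true s e = 1.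
  have : side_coord true s e <> 0.
    by move=> z1; move: e0; rewrite (@side_coord_eq0 true s s2 e z1 E2) eqxx.
  by lia.
suff <- : e = (if s then 1 else -1, 0) by exists p'.
rewrite [LHS]surjective_pairing; move: E1 E2; rewrite /side_coord.
by case: (s); case: (s2) => /= ? ?; congr pair; lia.
Qed.

(** The side of the component of [p] on which that of [q] lies can be read off at either end. *)
Lemma side_order p q a a' b b' : ~ p ~~ q -> p ~~ a -> a.1 = 0 -> p ~~ a' -> a'.1 = 1 ->
  q ~~ b -> b.1 = 0 -> q ~~ b' -> b'.1 = 1 -> (b.2 < a.2) = (b'.2 < a'.2).
Proof.
move=> npq pa a0 pa' a1 qb b0 qb' b1.
have [g [gc gv]] := comp_side frac npq pa a0 pa' a1.
have [/(_ b0) <- _ _ _] := gv _ qb; have [_ /(_ b1) <- _ _] := gv _ qb'.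
exact: gc.
Qed.

Lemma left_extremum (s : bool) : exists t, [/\ F t, t.1 = 0 &
  forall u, F u -> u.1 = 0 -> if s then u.2 <= t.2 else t.2 <= u.2].
Proof.
have cL : compact (F `&` [set u | u.1 = 0]).
  apply: compact_closedI (fractal_compact frac) _.
  have -> : [set u : R * R | u.1 = 0] = fst @^-1` [set 0] by [].
  apply: closed_comp; last exact: closed_eq.
  by move=> x _; exact: cvg_fst.
have L0 : F `&` [set u | u.1 = 0] !=set0.
  have [p Fp] := fractal_neq0 frac; have [a pa a0] := left_point Fp.
  by exists a; split=> //; have [] := same_comp_in pa.
have cs : {within F `&` [set u | u.1 = 0], continuous (fun z : R * R => z.2)}.
  by apply: continuous_subspaceT => z; exact: cvg_snd.
case: s.
  have [t /set_mem[Ft t0] tmax] := compact_EVT_max L0 cL cs.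
  by exists t; split=> // u Fu u0; apply: tmax; exact: mem_set.
have [t /set_mem[Ft t0] tmin] := compact_EVT_min L0 cL cs.
by exists t; split=> // u Fu u0; apply: tmin; exact: mem_set.
Qed.

Definition extreme (s : bool) (t : R * R) := F t /\
  forall q a b, F q -> ~ t ~~ q -> t ~~ a -> q ~~ b ->
    (a.1 = 0 /\ b.1 = 0) \/ (a.1 = 1 /\ b.1 = 1) -> if s then b.2 < a.2 else a.2 < b.2.

(** A highest or lowest point of [F] on the left side determines the component; [side_order]
    transfers the comparison to the right side. *)
Lemma extreme_exists s : exists t, extreme s t.
Proof.
have [t [Ft t0 tm]] := left_extremum s; exists t; split=> // q a b Fq ntq ta qb ab.
have [_ Fb] := same_comp_in qb.
have [b0 qb0 b00] := left_point Fq; have [_ Fb0] := same_comp_in qb0.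
have [a1 ta1 a11] := right_point Ft; have [b1 qb1 b11] := right_point Fq.
have h0 : (b0.2 < t.2) = s.
  have := tm _ Fb0 b00; case: (s); last by move=> h; rewrite ltNge h.
  rewrite le_eqVlt => /predU1P[E|//]; case: ntq.
  suff -> : t = b0 by exact: comp_sym.
  by rewrite [t]surjective_pairing [b0]surjective_pairing t0 b00 E.
have h1 : (b0.2 < t.2) = (b1.2 < a1.2) by apply: (@side_order t q) => //; exact: comp_refl.
have h : (b.2 < a.2) = (b0.2 < t.2).
  case: ab => -[aE bE].
    by rewrite h1; apply: (@side_order t q).
  by symmetry; apply: (@side_order t q) => //; exact: comp_refl.
have nab : a.2 <> b.2.
  move=> E; apply: ntq; suff E' : a = b by rewrite E' in ta; exact: comp_trans (comp_sym qb).
  rewrite [a]surjective_pairing [b]surjective_pairing E.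
  by congr pair; case: ab => -[-> ->].
move: h0; rewrite -h; case: (s) => // /negbT; rewrite -leNgt le_eqVlt.
by move=> /predU1P[/nab|].
Qed.

(** The contact puts [z] on the outer edge of the square, hence beyond the extreme component, while
    along the left side every other component lies within it. *)
Lemma extreme_vertical s t z e : extreme s t -> F z -> contact z e ->
  e.2 = (if s then 1 else -1) -> t ~~ z.
Proof.
move=> [Ft tx] Fz ce e2; apply: contrapT => ntz.
have z2 : z.2 = if s then 1 else 0.
  apply: (contact_touches frac (b := false) (s := s) Fz ce).
  by rewrite /side_coord e2; case: (s).
have [a ta a0] := left_point Ft; have [a' ta' a1] := right_point Ft.
have [b zb b0] := left_point Fz.
have [g [gc gv]] := comp_side frac ntz ta a0 ta' a1.
have [/(_ b0) gb _ _ _] := gv _ zb; have [_ _ gt gb'] := gv _ (comp_refl Fz).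
have := tx _ _ _ Fz ntz ta zb (or_introl (conj a0 b0)).
have gg := gc _ _ zb (comp_refl Fz).
move: z2 gg; rewrite gb; case: (s) => /= z2.
  by rewrite (gt z2) => ->.
by rewrite (gb' z2) => + h; rewrite ltNge (ltW h).
Qed.

(** Suppose the contacts on the right and on the left both lead to other components. Extremality at
    the two sides then gives opposite strict inequalities between the same two heights. *)
Lemma extreme_self_contact s t : extreme s t ->
  exists z q, [/\ t ~~ z, t ~~ q & z = translate (1, 0) q].
Proof.
move=> [Ft tx].
have [z1 tz1 [q1 Fq1 E1]] := horizontal_contact true Ft.
have [tq1|ntq1] := pselect (t ~~ q1); first by exists z1, q1.
have [z2 tz2 [q2 Fq2 E2]] := horizontal_contact false Ft.
have E2' : q2 = translate (1, 0) z2.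
  by have := translateK E2; congr (_ = translate _ _).
have [tq2|ntq2] := pselect (t ~~ q2); first by exists q2, z2.
have [_ Fz1] := same_comp_in tz1; have [_ Fz2] := same_comp_in tz2.
have [z11 q11] : z1.1 = 1 /\ q1.1 = 0.
  move: (fractal_unit frac Fz1) (fractal_unit frac Fq1).
  rewrite E1 /unit_square /translate /= => /andP[/andP[? ?] _] /andP[/andP[? ?] _].
  by split; lra.
have [q21 z21] : q2.1 = 1 /\ z2.1 = 0.
  move: (fractal_unit frac Fz2) (fractal_unit frac Fq2).
  rewrite E2' /unit_square /translate /= => /andP[/andP[? ?] _] /andP[/andP[? ?] _].
  by split; lra.
have h1 := tx _ _ _ Fq1 ntq1 tz2 (comp_refl Fq1) (or_introl (conj z21 q11)).
have h2 := tx _ _ _ Fq2 ntq2 tz1 (comp_refl Fq2) (or_intror (conj z11 q21)).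
move: h1 h2; rewrite E1 E2' /translate /= !addr0; case: (s) => h1 h2.
  by have := lt_trans h1 h2; rewrite ltxx.
by have := lt_trans h1 h2; rewrite ltxx.
Qed.

Lemma extremes_distinct t b : extreme true t -> extreme false b -> ~ t ~~ b.
Proof.
move=> [Ft tx] [Fb bx] tb; have [q Fq ntq] := comp_other disc Ft.
have [a ta a0] := left_point Ft; have [c qc c0] := left_point Fq.
have := tx _ _ _ Fq ntq ta qc (or_introl (conj a0 c0)).
have nbq : ~ b ~~ q by move=> bq; apply: ntq; exact: comp_trans bq.
have ba : b ~~ a by apply: comp_trans ta; exact: comp_sym.
have /ltW := bx _ _ _ Fq nbq ba qc (or_introl (conj a0 c0)).
by rewrite leNgt => /negP.
Qed.

End Strands.

(** * Rows of adjacent cells *)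

Section Runs.
Context {R : realType} (N : nat) (D : set (int * int)) (F : set (R * R)).
Implicit Types (z p q : R * R) (v w d : int * int) (n : nat).

Hypothesis frac : fractal N D F.
Hypothesis clopen_comp : closed_classes F (same_comp F).
Hypothesis disc : exists z z', [/\ F z, F z' & ~ same_comp F z z'].
Hypothesis horizontal : forall p, F p -> spans F p true /\ ~ spans F p false.
Variables (t b : R * R).
Hypotheses (t_top : extreme F true t) (b_bot : extreme F false b).

Local Notation "z ~~ z'" := (same_comp F z z') (at level 70).
Local Notation contact := (contact F).

Let N_gt1 : (1 < N)%N. Proof. exact: fractal_N frac. Qed.
Let N_gt0 : (0 < N)%N. Proof. exact: ltnW. Qed.
Let Ft : F t. Proof. by case: t_top. Qed.
Let Fb : F b. Proof. by case: b_bot. Qed.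

(** [(k, z)] stands for the point [z] of the [k]-th copy of [F] in a horizontal
    row of [l] adjacent copies. *)
Definition run_step (l : nat) (x y : nat * (R * R)) := [/\ (x.1 < l)%N, (y.1 < l)%N &
  (x.1 = y.1 /\ x.2 ~~ y.2) \/
  [/\ y.1 = x.1.+1, F x.2, F y.2 & x.2 = translate (1, 0) y.2]].

Definition run_rel l := eqv_span (run_step l).

Lemma run_comp l k z z' : (k < l)%N -> z ~~ z' -> run_rel l (k, z) (k, z').
Proof. by move=> kl zz'; apply: eqv_span_incl; split=> //; left. Qed.

Lemma run_next l k z z' : (k.+1 < l)%N -> F z -> F z' -> z = translate (1, 0) z' ->
  run_rel l (k, z) (k.+1, z').
Proof. by move=> kl Fz Fz' E; apply: eqv_span_incl; split; [exact: ltnW| |right]. Qed.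

Lemma run_shift l l' m x y : (m + l <= l')%N -> run_rel l x y ->
  run_rel l' (x.1 + m, x.2)%N (y.1 + m, y.2)%N.
Proof.
move=> ml; move: x y; apply: (@eqv_span_min _ _ (fun x y : nat * (R * R) =>
  run_rel l' (x.1 + m, x.2)%N (y.1 + m, y.2)%N)).
  exact: (equivalence_on_preim (fun x => ((x.1 + m)%N, x.2))) (eqv_span_equiv _).
move=> [k z] [k' z'] [/= kl kl' h]; apply: eqv_span_incl; split=> /=.
- by apply: leq_trans ml; rewrite addnC ltn_add2l.
- by apply: leq_trans ml; rewrite addnC ltn_add2l.
- by case: h => [[-> ?]|[-> ? ? ?]]; [left|right].
Qed.

Lemma run_extreme l s u k k' : extreme F s u -> (k < l)%N -> (k' < l)%N ->
  run_rel l (k, u) (k', u).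
Proof.
move=> ux; have Fu : F u by case: ux.
have [z [q [uz uq E]]] := extreme_self_contact frac clopen_comp disc horizontal ux.
have [_ Fz] := same_comp_in uz; have [_ Fq] := same_comp_in uq.
suff h m : (m < l)%N -> run_rel l (0%N, u) (m, u).
  by move=> kl kl'; exact: eqv_span_trans (eqv_span_sym (h _ kl)) (h _ kl').
elim: m => [|m IH] ml; first exact: eqv_span_refl.
apply: eqv_span_trans (IH (ltnW ml)) _.
apply: eqv_span_trans (run_comp (ltnW ml) uz) _.
apply: eqv_span_trans (run_next ml Fz Fq E) _.
by apply: (run_comp ml); exact: comp_sym.
Qed.

Lemma run_cells l (i j : int) x y : (forall k, (k < l)%N -> D (i + k%:Z, j)) ->
  run_rel l x y -> F x.2 -> (x.1 < l)%N ->
  cell N (i + x.1%:Z, j) x.2 ~~ cell N (i + y.1%:Z, j) y.2.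
Proof.
move=> Dr xy Fx xl.
pose c (x : nat * (R * R)) := cell N (i + x.1%:Z, j) x.2.
(* [eqv_span] is reflexive everywhere but [same_comp] only on [F], so equality is kept as an
   alternative during the induction. *)
suff [<-|] : x = y \/ c x ~~ c y by [exact/comp_refl/(fractal_cell frac)/Fx/Dr|].
move: xy; apply: (@eqv_span_min _ _ (fun x y => x = y \/ c x ~~ c y)).
  split; [by left|by move=> ? ? [->|/comp_sym]; [left|right]|].
  by move=> ? ? ? [->|h] // [<-|h']; right=> //; exact: comp_trans h'.
move=> [k z] [k' z'] [/= kl kl' h]; right; rewrite /c /=.
case: h => [[E zz']|[E' Fz Fz' E]]; subst k'.
  by apply: (same_comp_cell frac) => //; exact: Dr.
have -> : cell N (i + k%:Z, j) z = cell N (i + k.+1%:Z, j) z'.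
  apply/(cell_eq _ _ _ _ N_gt0); rewrite E; congr translate.
  by congr pair => /=; lia.
by apply: comp_refl; apply: (fractal_cell frac) => //; exact: Dr.
Qed.

Definition good_run l := forall k z, (k < l)%N -> F z ->
  run_rel l (k, z) (0%N, t) \/ run_rel l (k, z) (0%N, b).

Definition full_run l := forall k k' z z', (k < l)%N -> (k' < l)%N -> F z -> F z' ->
  run_rel l (k, z) (k', z').

(** A class of the row which avoids both extreme components is a component of
    [F] by itself, so it reaches both sides of the square. *)
Lemma maximal_run_good l (i j : int) : (forall k, (k < l)%N -> D (i + k%:Z, j)) ->
  ~ D (i - 1, j) -> ~ D (i + l%:Z, j) -> l != N -> good_run l.
Proof.
move=> Dr Dl Dr' lN k z kl Fz; apply: contrapT => /not_orP[nt nb].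
pose W := [set u | exists k' y, [/\ (k' < l)%N, F y, run_rel l (k, z) (k', y) &
  u = cell N (i + k'%:Z, j) y]].
have satW v p p' : D v -> p ~~ p' -> W (cell N v p) -> W (cell N v p').
  move=> Dv pp' [k' [y [k'l Fy zy E]]]; have [Fp Fp'] := same_comp_in pp'.
  have [e [Ey ce vE]] : exists e : int * int, [/\ y = translate e p, contact y e &
      v = (i + k'%:Z + e.1, j + e.2)].
    exists (v.1 - (i + k'%:Z), v.2 - j).
    have Ey : y = translate (v - (i + k'%:Z, j)) p by apply/(cell_eq _ _ _ _ N_gt0).
    split=> //; first by exists p.
    by rewrite [LHS]surjective_pairing /=; congr pair; lia.
  have next m x : (m < l)%N -> run_rel l (k, z) (m, x) -> x ~~ p' ->
      v = (i + m%:Z, j) -> W (cell N v p').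
    move=> ml zx xp' vm; exists m, p'; split=> //; last by rewrite vm.
    by apply: eqv_span_trans zx _; exact: run_comp.
  have := contact_range frac Fy ce; rewrite !ler_norml => /andP[e1r e2r].
  (* A vertical contact passes through an extreme component and would connect the class to [t] or
     [b]. *)
  have e20 : e.2 = 0.
    have n1 : e.2 <> 1.
      move=> e2; apply: nt; apply: eqv_span_trans zy _.
      have ty := extreme_vertical frac horizontal t_top Fy ce e2.
      apply: eqv_span_trans (run_comp k'l (comp_sym ty)) _.
      by apply: (run_extreme t_top) => //; case: (l) k'l.
    have n2 : e.2 <> -1.
      move=> e2; apply: nb; apply: eqv_span_trans zy _.
      have ty := extreme_vertical frac horizontal b_bot Fy ce e2.
      apply: eqv_span_trans (run_comp k'l (comp_sym ty)) _.
      by apply: (run_extreme b_bot) => //; case: (l) k'l.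
    by lia.
  have [e1|[e1|e1]] : e.1 = 0 \/ e.1 = 1 \/ e.1 = -1 by lia.
  - apply: (next k' y) => //; last by rewrite vE e1 e20 !addr0.
    suff -> : y = p by []. rewrite Ey [e]surjective_pairing e1 e20. exact: translate0.
  - have vE' : v = (i + k'.+1%:Z, j) by rewrite vE e1 e20; congr pair; lia.
    have k'l' : (k'.+1 < l)%N.
      rewrite ltn_neqAle k'l andbT; apply/eqP => E'; apply: Dr'.
      by rewrite -E' -vE'.
    apply: (next k'.+1 p) => //; apply: eqv_span_trans zy _; apply: run_next => //.
    by rewrite Ey; congr translate; rewrite [e]surjective_pairing e1 e20.
  - case: k' k'l zy E Ey vE => [|k'] k'l zy E Ey vE.
      by case: Dl; move: Dv; rewrite vE e1 e20 addr0 addr0.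
    apply: (next k' p) => //; [exact: ltnW| |by rewrite vE e1 e20; congr pair; lia].
    have py : run_rel l (k', p) (k'.+1, y).
      apply: run_next => //; suff <- : - e = (1, 0) by exact: translateK.
      by rewrite [e]surjective_pairing e1 e20.
    exact: eqv_span_trans zy (eqv_span_sym py).
have Wk : W (cell N (i + k%:Z, j) z) by exists k, z; split=> //; exact: eqv_span_refl.
have Fc : F (cell N (i + k%:Z, j) z) by apply: (fractal_cell frac) => //; exact: Dr.
have N0 : 0 < N%:R :> R by rewrite ltr0n.
(* The component remains in the run but reaches both sides of the square, which forces [l = N]. *)
have [u cu u0] := left_point horizontal Fc; have [u' cu' u1] := right_point horizontal Fc.
have [k1 [y [k1l Fy _ uE]]] := same_comp_ind frac clopen_comp satW cu Wk.
have [k2 [y' [k2l Fy' _ uE']]] := same_comp_ind frac clopen_comp satW cu' Wk.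
have /andP[/andP[/= i1 _] _] := fractal_box frac (Dr _ k1l).
have /andP[/andP[/= i2 i2'] _] := fractal_box frac (Dr _ k2l).
have /andP[/andP[y0 _] _] := fractal_unit frac Fy.
have /andP[/andP[_ y1] _] := fractal_unit frac Fy'.
have i0 : i + k1%:Z = 0.
  apply/eqP; rewrite eq_le i1 andbT -(ler_int R).
  move: u0; rewrite uE /= => /eqP; rewrite mulf_eq0 invr_eq0 (gt_eqF N0) orbF => /eqP.
  by lra.
have iN : N%:Z - 1 <= i + k2%:Z.
  rewrite -(ler_int R) intrB -pmulrn.
  have := congr1 (fun r => r * N%:R) u1; rewrite uE' /= divfK ?gt_eqF // mul1r.
  by lra.
have l0 : (0 < l)%N by case: (l) kl.
have := fractal_box frac (Dr 0%N l0); have := fractal_box frac (Dr l.-1 _).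
rewrite ltn_predL l0 => /(_ isT) /andP[/andP[_ /= h1] _] /andP[/andP[/= h2 _] _].
by move/eqP: lN; lia.
Qed.

(** Every position of the longer row lies in a window of [l] consecutive ones, and the extreme
    components run through the whole row. *)
Lemma good_run_cover l l' k z : good_run l -> (l <= l')%N -> (k < l')%N -> (0 < l)%N -> F z ->
  run_rel l' (k, z) (0%N, t) \/ run_rel l' (k, z) (0%N, b).
Proof.
move=> gl ll' kl' l0 Fz; pose m := minn k (l' - l).
have ml : (m + l <= l')%N by rewrite /m; lia.
have kml : (k - m < l)%N by rewrite /m; lia.
have kE : k = (k - m + m)%N by rewrite /m; lia.
have ml' : (m < l')%N by lia.
have l'0 : (0 < l')%N by lia.
case: (gl _ _ kml Fz) => /(run_shift ml) /=; rewrite -kE add0n => h.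
  by left; apply: eqv_span_trans h _; exact: (run_extreme t_top).
by right; apply: eqv_span_trans h _; exact: (run_extreme b_bot).
Qed.

End Runs.

(** * Sets of components invariant under horizontal contact *)

Section InvariantSet.
Context {R : realType} (N : nat) (D : set (int * int)) (F : set (R * R)).
Implicit Types (z p q : R * R) (v w d : int * int) (n : nat) (r : int).

Hypothesis frac : fractal N D F.
Hypothesis clopen_comp : closed_classes F (same_comp F).
Hypothesis disc : exists z z', [/\ F z, F z' & ~ same_comp F z z'].
Hypothesis horizontal : forall p, F p -> spans F p true /\ ~ spans F p false.
Variables (t b : R * R).
Hypotheses (t_top : extreme F true t) (b_bot : extreme F false b).

Local Notation "z ~~ z'" := (same_comp F z z') (at level 70).
Local Notation contact := (contact F).

Let N_gt1 : (1 < N)%N. Proof. exact: fractal_N frac. Qed.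
Let N_gt0 : (0 < N)%N. Proof. exact: ltnW. Qed.
Let Ft : F t. Proof. by case: t_top. Qed.
Let Fb : F b. Proof. by case: b_bot. Qed.

Variable A : set (R * R).
Hypothesis A_comp : forall z z', z ~~ z' -> A z -> A z'.
Hypothesis A_next : forall z z', F z -> F z' -> z = translate (1, 0) z' -> (A z <-> A z').
Hypotheses (At : A t) (nAb : ~ A b).

Let weight p : int := if `[< A p >] then 1 else 0.

(** [z] lies in a cell of order [n] of vertical index [w.2]. The top part of
    that cell can only meet the bottom part of the cell above it, whence the
    value [r] shared by both. *)
Definition row_index n z r := exists w p,
  [/\ F p, (z.1 * N%:R ^+ n, z.2 * N%:R ^+ n) = translate w p & r = w.2 + weight p].

(** Two representations differ by a contact. A horizontal one preserves [A]; a vertical one joins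
    the top component of the lower cell, of weight 1, to the bottom component of the upper cell, of
    weight 0. *)
Lemma row_index_uniq n z r r' : row_index n z r -> row_index n z r' -> r = r'.
Proof.
move=> [w [p [Fp Ez ->]]] [w' [p' [Fp' Ez' ->]]].
have E : translate w p = translate w' p' by exact: etrans (esym Ez) Ez'.
have [e [Ep we]] : exists e : int * int, p = translate e p' /\ w' = (w.1 + e.1, w.2 + e.2).
  exists (w'.1 - w.1, w'.2 - w.2); split; last first.
    by rewrite [LHS]surjective_pairing /=; congr pair; lia.
  move: E; rewrite /translate /= [p]surjective_pairing => -[/= E1 E2].
  rewrite !intrB; congr pair.
    by rewrite addrA -E1 addrK.
  by rewrite addrA -E2 addrK.
have Ep' : p' = translate (- e) p := translateK Ep.
have ce : contact p e by exists p'.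
have ce' : contact p' (- e) by exists p.
have := contact_range frac Fp ce; rewrite !ler_norml => /andP[e1r e2r].
rewrite we /=.
have At' x : t ~~ x -> weight x = 1 by move=> tx; rewrite /weight asboolT //; exact: A_comp At.
have Ab' x : b ~~ x -> weight x = 0.
  by move=> bx; rewrite /weight asboolF // => Ax; apply/nAb/(A_comp (comp_sym bx)).
have [e2|[e2|e2]] : e.2 = 0 \/ e.2 = 1 \/ e.2 = -1 by lia.
- rewrite e2 addr0; congr (_ + _); rewrite /weight.
  have AA : A p <-> A p'.
    have [e1|[e1|e1]] : e.1 = 0 \/ e.1 = 1 \/ e.1 = -1 by lia.
    + by rewrite Ep [e]surjective_pairing e1 e2 translate0.
    + by apply: A_next => //; rewrite Ep [e]surjective_pairing e1 e2.
    + apply: iff_sym; apply: A_next => //; rewrite {1}Ep'; congr translate.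
      by rewrite [e]surjective_pairing e1 e2.
  by congr (if _ then _ else _); apply/asbool_equiv_eq.
- rewrite e2 (At' p) ?(Ab' p') ?addr0 //.
    by apply: (extreme_vertical frac horizontal b_bot Fp' ce'); rewrite /= e2.
  exact: (extreme_vertical frac horizontal t_top Fp ce e2).
- rewrite e2 (At' p') ?(Ab' p) ?addr0 ?subrK //.
    exact: (extreme_vertical frac horizontal b_bot Fp ce e2).
  by apply: (extreme_vertical frac horizontal t_top Fp' ce'); rewrite /= e2 opprK.
Qed.

Lemma row_index_cell n v p r : row_index n p r ->
  row_index n.+1 (cell N v p) (r + v.2 * N%:Z ^+ n).
Proof.
move=> [w [q [Fq E ->]]]; exists (w.1 + v.1 * N%:Z ^+ n, w.2 + v.2 * N%:Z ^+ n), q.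
split=> //=; last by rewrite addrAC.
move: E; rewrite /translate /= => -[E1 E2].
have N0 : N%:R != 0 :> R by rewrite pnatr_eq0 -lt0n.
rewrite !intrD !intrM !rmorphXn /= -!pmulrn !addrA -E1 -E2 exprS.
by congr pair; field.
Qed.

Lemma row_index0 z : F z -> row_index 0 z (weight z).
Proof.
move=> Fz; exists 0, z; split=> //; last by rewrite add0r.
by rewrite translate0 !expr0 !mulr1 -surjective_pairing.
Qed.

Lemma row_index_exists n z : F z -> exists r, row_index n z r.
Proof.
elim: n z => [|n IH] z Fz; first by exists (weight z); exact: row_index0.
have [v [p [Dv Fp ->]]] := fractal_cellP frac Fz.
by have [r /(row_index_cell v) rp] := IH p Fp; exists (r + v.2 * N%:Z ^+ n).
Qed.

(** The [n]-fold refinement of the relation [A z <-> A z'] has closed classes, so it contains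
    [same_comp], and its links preserve the index of order [n]. *)
Lemma row_index_comp n z z' r : z ~~ z' -> row_index n z r -> row_index n z' r.
Proof.
pose EA m := iter m (refine_rel N D F) (fun z z' => A z <-> A z').
have eqEA m : equivalence_on (EA m).
  by case: m => [|m]; [exact: equivalence_on_iff|exact: refine_rel_equiv].
have clEA m : closed_classes F (EA m).
  elim: m => [|m IH]; last exact: closed_classes_refine.
  move=> G GA; apply: clopen_comp => x y Fx Fy xy; apply: GA => //.
  by split; apply: A_comp => //; exact: comp_sym.
move=> zz'; have [Fz Fz'] := same_comp_in zz'.
move: zz' => /(same_comp_sub (eqEA n) (clEA n)).
elim: n z z' r Fz Fz' => [|n IH] z z' r Fz Fz'.
  move=> /= AA rz; rewrite (row_index_uniq rz (row_index0 Fz)).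
  have -> : weight z = weight z'; last exact: row_index0.
  by congr (if _ then _ else _); apply/asbool_equiv_eq.
move=> zz'; have : (forall r, row_index n.+1 z r <-> row_index n.+1 z' r); last by move=> h /h.
move: z z' zz' {r Fz Fz'}; apply: eqv_span_min.
  split=> // [x y h r|x y u h h' r]; first by rewrite h.
  by rewrite h.
move=> _ _ [v [p [p' [Dv Fp Fp' pp' [-> ->]]]]] r.
have {}IH q q' : F q -> F q' -> EA n q q' -> row_index n.+1 (cell N v q) r ->
    row_index n.+1 (cell N v q') r.
  move=> Fq Fq' qq' rq; have [r0 r0q] := row_index_exists n Fq.
  rewrite (row_index_uniq rq (row_index_cell v r0q)); apply: row_index_cell.
  exact: IH r0q.
by split; apply: IH => //; have [_ s _] := eqEA n; exact: s.
Qed.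

(** Points with the same index of order [n] differ in height by at most [2 / N ^ n]. *)
Lemma comp_height z z' : z ~~ z' -> z.2 = z'.2.
Proof.
move=> zz'; have [Fz Fz'] := same_comp_in zz'.
apply: contrapT => /eqP; rewrite -subr_eq0 -normr_gt0 => d0.
have [n hn] := pow_small 2 N_gt1 d0.
have [r rz] := row_index_exists n Fz; have rz' := row_index_comp zz' rz.
have wt p : 0 <= (weight p)%:~R :> R /\ (weight p)%:~R <= 1 :> R.
  by rewrite /weight; case: asboolP => _; rewrite ?ler01 ?lexx.
have bound u s : row_index n u s -> `|u.2 * N%:R ^+ n - s%:~R| <= 1.
  move=> [w [p [Fp /(congr1 snd) /= -> ->]]].
  have /andP[_ /andP[p1 p2]] := fractal_unit frac Fp; have [w1 w2] := wt p.
  by rewrite intrD ler_norml; apply/andP; split; lra.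
have := bound _ _ rz; have := bound _ _ rz'; rewrite !ler_norml => /andP[a1 a2] /andP[a3 a4].
have Nn : 0 < N%:R ^+ n :> R by rewrite exprn_gt0 // ltr0n.
move: hn; rewrite ltr_pdivrMr // -[X in _ * X](gtr0_norm Nn) -normrM ltNge.
by rewrite mulrBl ler_norml => /negP; apply; apply/andP; split; lra.
Qed.

(** Components would be flat, while a high iterate of a cell maps the uppermost
    and the lowermost one into the same component. *)
Lemma no_invariant_set : False.
Proof.
have [v Dv] := fractal_digits_neq0 frac.
have [n hn] := cell_contracts frac clopen_comp Dv.
have htb : t.2 <> b.2.
  move=> E; apply: nAb; have [a ta a0] := left_point horizontal Ft.
  have [c bc c0] := left_point horizontal Fb.
  have ntb : ~ t ~~ b by move=> tb; apply: nAb; exact: A_comp At.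
  case: t_top => _ /(_ _ _ _ Fb ntb ta bc (or_introl (conj a0 c0))).
  by rewrite -(comp_height ta) -(comp_height bc) E ltxx.
have iter_inj m p q : (iter m (cell N v) p).2 = (iter m (cell N v) q).2 -> p.2 = q.2.
  elim: m => //= m IH; rewrite /= => /mulIf h; apply: IH; apply: (addIr v.2%:~R).
  by apply: h; rewrite invr_eq0 pnatr_eq0 -lt0n.
exact: htb (iter_inj _ _ _ (comp_height (hn _ _ Ft Fb))).
Qed.

End InvariantSet.

(** * Run lengths and the second refinement *)

Section SecondLevel.
Context {R : realType} (N : nat) (D : set (int * int)) (F : set (R * R)).
Implicit Types (z p q : R * R) (v w d : int * int) (n l k : nat) (i j : int).

Hypothesis frac : fractal N D F.
Hypothesis clopen_comp : closed_classes F (same_comp F).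
Hypothesis disc : exists z z', [/\ F z, F z' & ~ same_comp F z z'].
Hypothesis horizontal : forall p, F p -> spans F p true /\ ~ spans F p false.
Variables (t b : R * R).
Hypotheses (t_top : extreme F true t) (b_bot : extreme F false b).

Local Notation "z ~~ z'" := (same_comp F z z') (at level 70).
Local Notation good_run := (good_run F t b).
Local Notation full_run := (full_run F).
Local Notation run_rel := (run_rel F).

Let N_gt1 : (1 < N)%N. Proof. exact: fractal_N frac. Qed.
Let N_gt0 : (0 < N)%N. Proof. exact: ltnW. Qed.
Let Ft : F t. Proof. by case: t_top. Qed.
Let Fb : F b. Proof. by case: b_bot. Qed.

(** Suppose [t] and [b] are not joined. The good runs at positions 0 and 1 then show that a strand
    has the same type at both, so the strands joined to [t] form a set forbidden by
    [no_invariant_set]. *)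
Lemma good_run_connects l : (0 < l)%N -> good_run l -> run_rel l.+1 (0%N, t) (0%N, b).
Proof.
move=> l0 gl; apply: contrapT => ntb.
have shift0 x y : run_rel l x y -> run_rel l.+1 x y.
  move=> xy; have := @run_shift _ F l l.+1 0 x y (leqnSn l) xy.
  by rewrite !addn0 -!surjective_pairing.
have At z : F z -> run_rel l.+1 (0%N, z) (0%N, t) -> run_rel l.+1 (1%N, z) (0%N, t).
  move=> Fz zt; case: (gl 0%N z l0 Fz) => h.
    apply: eqv_span_trans (@run_shift _ F l l.+1 1 _ _ (leqnn _) h) _.
    exact: (run_extreme frac clopen_comp disc horizontal t_top).
  by case: ntb; apply: eqv_span_trans (eqv_span_sym zt) _; exact: shift0.
have Ab z : F z -> ~ run_rel l.+1 (0%N, z) (0%N, t) -> run_rel l.+1 (1%N, z) (0%N, b).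
  move=> Fz nzt; case: (gl 0%N z l0 Fz) => h; first by case: nzt; exact: shift0.
  apply: eqv_span_trans (@run_shift _ F l l.+1 1 _ _ (leqnn _) h) _.
  exact: (run_extreme frac clopen_comp disc horizontal b_bot).
apply: (no_invariant_set frac clopen_comp horizontal t_top b_bot
  (A := [set z | run_rel l.+1 (0%N, z) (0%N, t)])) => /=.
- move=> z z' zz'; apply: eqv_span_trans; apply: run_comp => //; exact: comp_sym.
- move=> z z' Fz Fz' E; have zz' : run_rel l.+1 (0%N, z) (1%N, z') by exact: run_next.
  split=> h.
    apply: contrapT => /(Ab _ Fz') zb; apply: ntb.
    apply: eqv_span_trans (eqv_span_sym h) _; exact: eqv_span_trans zz' zb.
  exact: eqv_span_trans zz' (At _ Fz' h).
- exact: eqv_span_refl.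
- by move=> h; apply: ntb; exact: eqv_span_sym.
Qed.

Lemma good_run_full l l' : (0 < l)%N -> good_run l -> (l < l')%N -> full_run l'.
Proof.
move=> l0 gl ll'.
have tb : run_rel l' (0%N, t) (0%N, b).
  have := @run_shift _ F l.+1 l' 0 _ _ ll' (good_run_connects l0 gl).
  by rewrite /= addn0.
have h k z : (k < l')%N -> F z -> run_rel l' (k, z) (0%N, b).
  move=> kl' Fz; case: (good_run_cover frac clopen_comp disc horizontal t_top b_bot
    gl (ltnW ll') kl' l0 Fz) => // h; exact: eqv_span_trans h tb.
by move=> k k' z z' kl kl' Fz Fz'; exact: eqv_span_trans (h _ _ kl Fz) (eqv_span_sym (h _ _ kl' Fz')).
Qed.

Lemma maximal_run d : D d -> exists l k i, [/\ (k < l)%N, d = (i + k%:Z, d.2),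
  (forall m, (m < l)%N -> D (i + m%:Z, d.2)) & ~ D (i - 1, d.2) /\ ~ D (i + l%:Z, d.2)].
Proof.
move=> Dd; have box v : D v -> 0 <= v.1 < N by move=> /(fractal_box frac)/andP[].
have /= bd := box _ Dd.
have [|a /asboolP na amin] := @ex_minnP (fun a => `[< ~ D (d.1 - 1 - a%:Z, d.2) >]).
  by exists N; apply/asboolP => /box /=; lia.
have [|c /asboolP nc cmin] := @ex_minnP (fun c => `[< ~ D (d.1 + 1 + c%:Z, d.2) >]).
  by exists N; apply/asboolP => /box /=; lia.
exists (a + c).+1, a, (d.1 - a%:Z); split.
- by rewrite ltnS leq_addr.
- by rewrite subrK -surjective_pairing.
- move=> m mac; have [ma|am] := ltnP m a.
    apply: contrapT => nD; have := amin (a - m.+1)%N; rewrite leqNgt => h.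
    suff /h : `[< ~ D (d.1 - 1 - (a - m.+1)%N%:Z, d.2) >] by lia.
    apply/asboolP => h'; apply: nD; move: h'; congr (D (_, _)); lia.
  have [E|ne] := eqVneq m a.
    by rewrite E subrK -surjective_pairing.
  apply: contrapT => nD; have := cmin (m - a.+1)%N; rewrite leqNgt => h.
  suff /h : `[< ~ D (d.1 + 1 + (m - a.+1)%N%:Z, d.2) >] by lia.
  apply/asboolP => h'; apply: nD; move: h'; congr (D (_, _)); lia.
- split; first by move: na; congr (~ D (_, _)); lia.
  by move: nc; congr (~ D (_, _)); lia.
Qed.

Definition full_rows := forall d i, D d -> 0 <= i < N -> D (i, d.2).

Lemma full_rows_segment p (x : R) : full_rows -> F p -> 0 <= x <= 1 -> F (x, p.2).
Proof.
move=> fr Fp x01.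
have N0 : 0 < N%:R :> R by rewrite ltr0n.
have approx n : forall u (y : R), F u -> 0 <= y <= 1 ->
    exists2 q, F q & q.2 = u.2 /\ `|y - q.1| <= 1 / N%:R ^+ n.
  elim: n => [|n IH] u y Fu /andP[y0 y1].
    exists u => //; split=> //; rewrite expr0 divr1.
    by have /andP[/andP[? ?] _] := fractal_unit frac Fu; rewrite ler_norml; lra.
  have [v [u1 [Dv Fu1 ->]]] := fractal_cellP frac Fu.
  (* The minimum with [N - 1] takes care of [y = 1]. *)
  pose i := Order.min (Num.floor (N%:R * y)) (N%:Z - 1).
  have iN : 0 <= i < N.
    have : 0 <= Num.floor (N%:R * y) by rewrite floor_ge0 mulr_ge0 // ltW.
    by rewrite /i; case: (leP (Num.floor _) _); lia.
  have y01 : 0 <= N%:R * y - i%:~R <= 1.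
    have /andP[f1 f2] := floor_itv (N%:R * y).
    have hN : N%:R * y <= N%:R by rewrite ler_piMr // ltW.
    rewrite /i; case: (leP (Num.floor _) _) => h.
      by move: f2; rewrite intrD => f2; apply/andP; split; lra.
    have : (N%:Z - 1)%:~R <= (Num.floor (N%:R * y))%:~R :> R by rewrite ler_int ltW.
    by rewrite intrB -pmulrn => h'; apply/andP; split; lra.
  have [q Fq [q2 qy]] := IH u1 _ Fu1 y01.
  exists (cell N (i, v.2) q); first by apply: (fractal_cell frac) => //; exact: fr.
  split; rewrite /= ?q2 //.
  have -> : y - (q.1 + i%:~R) / N%:R = (N%:R * y - i%:~R - q.1) / N%:R.
    by field; rewrite gt_eqF.
  rewrite normrM (gtr0_norm (x := _^-1)) ?invr_gt0 // exprSr invfM mulrA.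
  by rewrite ler_pM2r ?invr_gt0.
apply: closed_approx => [|e e0]; first exact: fractal_closed frac.
have [n hn] := pow_small 1 N_gt1 e0; have [q Fq [q2 qx]] := approx n p x Fp x01.
exists q => //; split=> /=; first exact: le_lt_trans hn.
by rewrite q2 subrr normr0.
Qed.

Lemma full_rows_comp p q : full_rows -> F p -> F q -> p.2 = q.2 -> p ~~ q.
Proof.
move=> fr Fp Fq pq.
pose S := (fun x : R => (x, p.2)) @` `[0, 1]%classic.
have inS z : F z -> z.2 = p.2 -> S z.
  move=> /(fractal_unit frac) /andP[z01 _] zp; exists z.1; first by rewrite /= in_itv.
  by rewrite -zp -surjective_pairing.
apply: (connected_component_max (B := S)); [exact: inS| | |exact: inS].
  by move=> _ [x xI <-]; apply: full_rows_segment => //; move: xI; rewrite /= in_itv.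
apply: connected_continuous_connected; first exact: segment_connected.
apply: continuous_subspaceT => x B /nbhs_ballP[e /= e0 eB].
apply/nbhs_ballP; exists e => //= y xy; apply: eB; split=> //=; exact: ballxx.
Qed.

(** With full rows, points of [F] at equal height are joined by a segment in [F], so the component
    of [t] alone would be invariant under horizontal contact. *)
Lemma exists_partial_row : exists2 d, D d & exists2 i : int, 0 <= i < N & ~ D (i, d.2).
Proof.
apply: contrapT => h.
have fr : full_rows.
  by move=> d i Dd iN; apply: contrapT => nD; apply: h; exists d => //; exists i.
apply: (no_invariant_set frac clopen_comp horizontal t_top b_bot (A := [set z | t ~~ z])) => /=.
- by move=> z z' zz' tz; exact: comp_trans zz'.
- move=> z z' Fz Fz' E.
  have zz' : z ~~ z' by apply: full_rows_comp => //; rewrite E /translate /= addr0.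
  by split=> h'; [exact: comp_trans zz'|exact: comp_trans (comp_sym zz')].
- exact: comp_refl.
- exact: (extremes_distinct disc horizontal t_top b_bot).
Qed.

Lemma maximal_run_size d l i : (forall m, (m < l)%N -> D (i + m%:Z, d.2)) -> (0 < l)%N ->
  (l <= N)%N /\ (l = N -> i = 0).
Proof.
move=> Dr l0; have box v : D v -> 0 <= v.1 < N by move=> /(fractal_box frac)/andP[].
have /= h0 := box _ (Dr _ l0).
have := box _ (Dr l.-1 _); rewrite ltn_predL l0 => /(_ isT) /= h1.
by split; lia.
Qed.

Lemma exists_good_run : exists l, [/\ (0 < l)%N, (l < N)%N & good_run l].
Proof.
have [d Dd [i0 i0N nD]] := exists_partial_row.
have [l [k [i [kl dE Dr [nl nr]]]]] := maximal_run Dd.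
have l0 : (0 < l)%N by case: (l) kl.
have [lN iE] := maximal_run_size Dr l0.
have nlN : l != N.
  apply/eqP => E; apply: nD; have := iE E => i00; subst i l.
  have := Dr (absz i0); rewrite add0r gez0_abs; last by case/andP: i0N.
  by apply; lia.
exists l; split=> //; first by rewrite ltn_neqAle nlN.
exact: (maximal_run_good frac clopen_comp disc horizontal t_top b_bot Dr nl nr nlN).
Qed.

(** A run that fills its row is longer than the good run of [exists_good_run], hence full. *)
Lemma run_alternative d : D d -> exists l k i, [/\ (k < l)%N, d = (i + k%:Z, d.2),
  (forall m, (m < l)%N -> D (i + m%:Z, d.2)) & good_run l \/ full_run l].
Proof.
move=> Dd; have [l [k [i [kl dE Dr [nl nr]]]]] := maximal_run Dd.
exists l, k, i; split=> //; have [lN|lN] := eqVneq l N; [right|left].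
  have [l' [l'0 l'N gl']] := exists_good_run.
  by rewrite lN; exact: good_run_full gl' l'N.
exact: (maximal_run_good frac clopen_comp disc horizontal t_top b_bot Dr nl nr lN).
Qed.

Lemma good_run_uniq l l' : (0 < l)%N -> (0 < l')%N -> good_run l -> good_run l' ->
  ~ full_run l -> ~ full_run l' -> l = l'.
Proof.
move=> l0 l'0 gl gl' nl nl'; have [ll'|l'l|//] := ltngtP l l'.
  by case: nl'; exact: good_run_full gl ll'.
by case: nl; exact: good_run_full gl' l'l.
Qed.

Lemma level2_same_comp_strands z z' : F z -> F z' -> level N D F 2 z z' -> z ~~ z'.
Proof.
have cellE d k i p : d = (i + k%:Z, d.2) -> cell N d p = cell N (i + k%:Z, d.2) p.
  by move=> <-.
have runE d l k i p k' p' : d = (i + k%:Z, d.2) -> (forall m, (m < l)%N -> D (i + m%:Z, d.2)) ->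
    (k < l)%N -> F p -> run_rel l (k, p) (k', p') -> cell N d p ~~ cell N (i + k'%:Z, d.2) p'.
  move=> dE Dr kl Fp h; rewrite (cellE d k i p dE).
  exact: (run_cells frac Dr h).
(* Some class of [level 1] meets both parts of one column of a run with two parts. *)
pose straddle := exists l k p q, [/\ good_run l, ~ full_run l & (k < l)%N] /\
  [/\ F p, F q, level N D F 1 p q, run_rel l (k, p) (0%N, t) & run_rel l (k, q) (0%N, b)].
have [[l [k [p [q [[gl nl kl] [Fp Fq pq pt qb]]]]]]|nstr] := pselect straddle.
  have l0 : (0 < l)%N by case: (l) kl.
  (* All runs with two parts have length [l], so a copy of the straddling pair in column [k] joins
     [t] to [b] in each of them. *)
  have whole d u u' : D d -> F u -> F u' -> level N D F 2 (cell N d u) (cell N d u').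
    move=> Dd Fu Fu'; have [l' [k' [i [k'l' dE Dr gf]]]] := run_alternative Dd.
    have [_ _ trans] := level_equiv N D F 2; have [_ sym _] := level_equiv N D F 2.
    have l'0 : (0 < l')%N by case: (l') k'l'.
    have [fl'|nfl'] := pselect (full_run l').
      have := runE d l' k' i u k' u' dE Dr k'l' Fu (fl' _ _ _ _ k'l' k'l' Fu Fu').
      by rewrite -(cellE d k' i u' dE); exact: same_comp_level.
    have gl' : good_run l' by case: gf.
    have ll' := good_run_uniq l0 l'0 gl gl' nl nfl'; subst l'.
    have Dk := Dr _ kl.
    have tb : level N D F 2 (cell N (i + 0%:Z, d.2) t) (cell N (i + 0%:Z, d.2) b).
      have h1 := run_cells frac Dr pt Fp kl; have h2 := run_cells frac Dr qb Fq kl.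
      apply: (trans _ _ _ (same_comp_level frac 2 (comp_sym h1))).
      apply: (trans _ _ _ _ (same_comp_level frac 2 h2)).
      exact: refine_rel_cell.
    have toT x : F x -> level N D F 2 (cell N d x) (cell N (i + 0%:Z, d.2) t).
      move=> Fx; case: (gl _ _ k'l' Fx) => /(runE d l k' i x _ _ dE Dr k'l' Fx) h.
        exact: same_comp_level.
      by apply: (trans _ _ _ (same_comp_level frac 2 h)); exact: sym.
    exact: (trans _ _ _ (toT _ Fu) (sym _ _ (toT _ Fu'))).
  have l12 u u' : level N D F 1 u u' -> level N D F 2 u u'.
    apply: eqv_span_min; first exact: (level_equiv N D F 2).
    by move=> _ _ [d [w [w' [Dd Fw Fw' _ [-> ->]]]]]; exact: whole.
  (* Now [level 1] is fixed by refinement, so its classes are components. *)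
  move=> Fz Fz' /level_anti.
  apply: (refine_fixed_same_comp frac) => //.
  - exact: level_equiv.
  - exact: closed_classes_level.
  - by move=> u u' _ _; exact: l12.
  - by move=> u u'; exact: (@level_anti _ N D F 1).
(* Without straddling, points of a column related by [level 1] lie in the same part of the run, so
   every link of [level 2] stays in a component. *)
move=> Fz Fz' zz'; suff [->|//] : z = z' \/ z ~~ z' by exact: comp_refl.
move: zz'; apply: (@eqv_span_min _ _ (fun z z' => z = z' \/ z ~~ z')).
  split; [by left|by move=> ? ? [->|/comp_sym]; [left|right]|].
  by move=> ? ? ? [->|h] // [<-|h']; right=> //; exact: comp_trans h'.
move=> _ _ [d [p [p' [Dd Fp Fp' pp' [-> ->]]]]]; right.
have [l [k [i [kl dE Dr gf]]]] := run_alternative Dd.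
suff h : run_rel l (k, p) (k, p').
  by have := runE d l k i p k p' dE Dr kl Fp h; rewrite -(cellE d k i p' dE).
have [fl|nfl] := pselect (full_run l); first exact: fl.
have gl : good_run l by case: gf.
have nst u u' : F u -> F u' -> level N D F 1 u u' -> run_rel l (k, u) (0%N, t) ->
    run_rel l (k, u') (0%N, b) -> False.
  by move=> *; apply: nstr; exists l, k, u, u'.
have p'p : level N D F 1 p' p by have [_ s _] := level_equiv N D F 1; exact: s.
case: (gl _ _ kl Fp) (gl _ _ kl Fp') => hp [] hp'.
- exact: eqv_span_trans hp (eqv_span_sym hp').
- by case: (nst p p').
- by case: (nst p' p).
- exact: eqv_span_trans hp (eqv_span_sym hp').
Qed.

End SecondLevel.

(** * Transposition *)

Section Transpose.
Context {R : realType}.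
Implicit Types (F G : set (R * R)) (z p q : R * R).

Definition transpose {T : Type} (z : T * T) : T * T := (z.2, z.1).

Lemma transposeK {T : Type} : involutive (@transpose T).
Proof. by case. Qed.

Lemma transpose_continuous : continuous (@transpose R).
Proof. by apply: within_dist_continuous => e x y _ []. Qed.

Lemma same_comp_transpose F G z z' : (forall u, F u -> G (transpose u)) ->
  same_comp F z z' -> same_comp G (transpose z) (transpose z').
Proof.
move=> FG zz'; have [Fz _] := same_comp_in zz'.
apply: (connected_component_max (B := transpose @` connected_component F z)).
- by exists z => //; exact: connected_component_refl.
- by move=> _ [u /connected_component_sub Fu <-]; exact: FG.
- apply: connected_continuous_connected; first exact: component_connected.
  exact/continuous_subspaceT/transpose_continuous.
- by exists z'.
Qed.

Section TransposedSquare.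
Variables (N : nat) (D : set (int * int)) (F : set (R * R)).
Hypothesis frac : fractal N D F.
Hypothesis clopen_comp : closed_classes F (same_comp F).
Hypothesis disc : exists z z', [/\ F z, F z' & ~ same_comp F z z'].

Let Dt : set (int * int) := [set v | D (transpose v)].
Let Ft : set (R * R) := [set z | F (transpose z)].

Let FFt z : F z -> Ft (transpose z). Proof. by rewrite /Ft /= transposeK. Qed.

Let FtE z z' : same_comp Ft z z' <-> same_comp F (transpose z) (transpose z').
Proof.
split; first exact: same_comp_transpose.
by move=> /(same_comp_transpose FFt); rewrite !transposeK.
Qed.

Let DtE : Dt = transpose @` D.
Proof.
apply/seteqP; split=> [v Dv|_ [v Dv <-]]; last by rewrite /Dt /= transposeK.
by exists (transpose v); rewrite ?transposeK.
Qed.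

Let FtI : Ft = transpose @` F.
Proof.
apply/seteqP; split=> [v Fv|_ [v Fv <-]]; last exact: FFt.
by exists (transpose v); rewrite ?transposeK.
Qed.

Let frac_t : fractal N Dt Ft.
Proof.
split.
- exact: fractal_N frac.
- by rewrite DtE; apply: finite_image; exact: fractal_fin frac.
- by move=> v /(fractal_box frac) /andP[h1 h2]; rewrite h1 h2.
- by have [z Fz] := fractal_neq0 frac; exists (transpose z); exact: FFt.
- rewrite FtI; apply: continuous_compact; last exact: fractal_compact frac.
  exact/continuous_subspaceT/transpose_continuous.
- apply/seteqP; split=> [z /(fractal_cellP frac)[v [p [Dv Fp E]]]|].
    exists (transpose v); first by rewrite /Dt /= transposeK.
    exists (transpose p); first exact: FFt.
    by rewrite -[z]transposeK E.
  by move=> _ [v Dv [p Fp <-]]; exact: (fractal_cell frac Dv Fp).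
Qed.

Let closed_t : closed_classes Ft (same_comp Ft).
Proof.
move=> G GS; have -> : Ft `&` G = transpose @^-1` (F `&` [set z | G (transpose z)]).
  by apply/seteqP; split=> z []; rewrite /Ft /= ?transposeK.
apply: closed_comp; first by move=> z _; exact: transpose_continuous.
apply: clopen_comp => z z' Fz Fz' zz' /=; apply: GS; try exact: FFt.
by apply/FtE; rewrite !transposeK.
Qed.

Let disc_t : exists z z', [/\ Ft z, Ft z' & ~ same_comp Ft z z'].
Proof.
have [z [z' [Fz Fz' nzz']]] := disc; exists (transpose z), (transpose z').
by split; try exact: FFt; move=> /FtE; rewrite !transposeK.
Qed.

Let level_t n z z' : level N D F n z z' -> level N Dt Ft n (transpose z) (transpose z').
Proof.
elim: n z z' => [//|n IH]; apply: eqv_span_min.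
  exact/equivalence_on_preim/eqv_span_equiv.
move=> _ _ [v [p [p' [Dv Fp Fp' pp' [-> ->]]]]].
apply: (@refine_rel_cell _ N Dt Ft _ (transpose v) (transpose p) (transpose p')).
- by rewrite /Dt /= transposeK.
- exact: FFt.
- exact: FFt.
- exact: IH.
Qed.

Let spans_t p b : spans F p b -> spans Ft (transpose p) (~~ b).
Proof.
have h s : touches F p b s -> touches Ft (transpose p) (~~ b) s.
  move=> [p' pp' E]; exists (transpose p'); first by apply/FtE; rewrite !transposeK.
  by move: E; case: (b).
by move=> [? ?]; split; exact: h.
Qed.

(** If no component joins left and right, all join top and bottom, and the transposed square is
    used. *)
Lemma level2_same_comp z z' : F z -> F z' -> level N D F 2 z z' -> same_comp F z z'.
Proof.
move=> Fz Fz' zz'; have [h|h] := pselect (exists2 p, F p & spans F p true).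
  have hor := spans_alternative frac clopen_comp disc h.
  have [t t_top] := extreme_exists frac hor true.
  have [b b_bot] := extreme_exists frac hor false.
  exact: (level2_same_comp_strands frac clopen_comp disc hor t_top b_bot).
have spF p : F p -> spans F p false.
  by move=> Fp; have [sp|//] := comp_spans frac clopen_comp disc Fp; case: h; exists p.
have ht : exists2 p, Ft p & spans Ft p true.
  by exists (transpose z); [exact: FFt|exact/(@spans_t _ false)/spF].
have hor := spans_alternative frac_t closed_t disc_t ht.
have [t t_top] := extreme_exists frac_t hor true.
have [b b_bot] := extreme_exists frac_t hor false.
have := level2_same_comp_strands frac_t closed_t disc_t hor t_top b_bot (FFt Fz) (FFt Fz') (level_t zz').
by move=> /FtE; rewrite !transposeK.
Qed.

End TransposedSquare.
End Transpose.

(** * Graph components as classes of a generated equivalence *)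

Section GraphComponents.
Variables (V : finType) (V0 : {set V}) (e : rel V).
Hypothesis e_sym : symmetric e.
Hypothesis V0_neq0 : V0 != finset.set0.

Let e0 := [rel u v | [&& u \in V0, v \in V0 & e u v]].
Let cl v := [set w in V0 | connect e0 v w]%SET.

Let e0_sym : connect_sym e0.
Proof. by apply: sym_connect_sym => u v /=; rewrite e_sym andbCA. Qed.

(** A walk in [V0] from a vertex of a class never leaves the class, so walks in the class and in
    [V0] agree. As [V0] is non-empty, the empty set is not maximal. *)
Lemma graph_componentsP A : reflect (exists2 v, v \in V0 & A = cl v) (A \in graph_components V0 e).
Proof.
have cl_conn v : v \in V0 -> connected_in V0 e (cl v).
  move=> vV0; apply/andP; split; first by apply/fintype.subsetP => w; rewrite inE => /andP[].
  apply/forall_inP => x; rewrite inE => /andP[xV0 vx].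
  apply/forall_inP => y; rewrite inE => /andP[_ vy].
  have : connect e0 x y by apply: connect_trans vy; rewrite e0_sym.
  move=> /connectP[p]; elim: p x xV0 vx => [|w p IH] x xV0 vx /= => [_ ->|].
    exact: connect0.
  move=> /andP[/and3P[_ wV0 xw] pw] yE.
  have vw : connect e0 v w by apply: connect_trans vx _; apply: connect1; rewrite /= xV0 wV0.
  apply: connect_trans (IH w wV0 vw pw yE); apply: connect1.
  by rewrite /= !inE xV0 vx wV0 vw.
have conn_cl B v : connected_in V0 e B -> v \in B -> B \subset cl v.
  move=> /andP[/fintype.subsetP BV0 /forall_inP hB] vB; apply/fintype.subsetP => w wB.
  rewrite inE BV0 //=; move/forall_inP: (hB v vB) => /(_ w wB).
  apply: connect_sub => x y /= /and3P[xB yB xy].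
  by apply: connect1; rewrite /= !BV0.
have vcl v : v \in V0 -> v \in cl v by move=> vV0; rewrite inE vV0 connect0.
rewrite inE; apply: (iffP maxsetP) => [[cA maxA]|[v vV0 ->]]; last first.
  split; first exact: cl_conn.
  move=> B cB /fintype.subsetP clB; apply/eqP; rewrite finset.eqEsubset; apply/andP; split.
    exact: conn_cl (clB _ (vcl _ vV0)).
  exact/fintype.subsetP.
have [A0|[v vA]] := finset.set_0Vmem A.
  have [v vV0] := finset.set0Pn _ V0_neq0.
  by have := vcl _ vV0; rewrite (maxA (cl v)) ?cl_conn // A0 ?inE // finset.sub0set.
have vV0 : v \in V0 by case/andP: cA => /fintype.subsetP->.
by exists v => //; rewrite (maxA (cl v)) ?cl_conn ?conn_cl.
Qed.

Lemma graph_component_eq A v : A \in graph_components V0 e -> v \in A -> v \in V0 /\ A = cl v.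
Proof.
move=> /graph_componentsP[u uV0 ->]; rewrite inE => /andP[vV0 uv]; split=> //.
by apply/finset.setP => w; rewrite !inE (same_connect e0_sym uv).
Qed.

End GraphComponents.

(** * Finite enumerations of equivalence classes *)

Section Indexing.
Context {T : Type}.
Implicit Types (F : set T) (E : T -> T -> Prop).

(** [Y] lists the classes of [E] on [F] without repetition; the last clause expresses both
    disjointness and saturation. *)
Definition indexes F E (I : finType) (Y : I -> set T) := [/\ forall i, Y i !=set0,
  forall i, Y i `<=` F, forall z, F z -> exists i, Y i z &
  forall i j z z', Y i z -> Y j z' -> (E z z' <-> i = j)].

Lemma indexes_ext F E E' (I : finType) (Y : I -> set T) :
  (forall z z', F z -> F z' -> (E z z' <-> E' z z')) -> indexes F E Y -> indexes F E' Y.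
Proof.
move=> EE' [Y0 YF FY YE]; split=> // i j z z' Yz Yz'.
by rewrite -(YE i j z z' Yz Yz'); apply: iff_sym; apply: EE'; [exact: YF Yz|exact: YF Yz'].
Qed.

(** The finer classes map onto the coarser ones, and a surjection of finite sets is injective
    exactly when the cardinals agree. *)
Lemma indexes_card F E1 E2 (I1 I2 : finType) (Y1 : I1 -> set T) (Y2 : I2 -> set T) :
  indexes F E1 Y1 -> indexes F E2 Y2 -> (forall z z', E2 z z' -> E1 z z') ->
  #|I1| = #|I2| <-> (forall z z', F z -> F z' -> E1 z z' -> E2 z z').
Proof.
move=> [Y10 Y1F FY1 Y1E] [Y20 Y2F FY2 Y2E] E21.
have [f fE] : exists f : I2 -> I1, forall j z i, Y2 j z -> Y1 i z -> f j = i.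
  have h j : exists i, forall z i', Y2 j z -> Y1 i' z -> i = i'.
    have [z0 z0j] := Y20 j; have [i iz0] := FY1 z0 (Y2F _ _ z0j).
    exists i => z i' zj zi'; apply/(Y1E _ _ _ _ iz0 zi')/E21.
    exact/(Y2E _ _ _ _ z0j zj).
  by have [f hf] := choice h; exists f => j z i; exact: hf.
have [g gE] : exists g : I1 -> I2, cancel g f.
  have h i : exists j, f j = i.
    have [z zi] := Y10 i; have [j jz] := FY2 z (Y1F _ _ zi).
    by exists j; exact: fE jz zi.
  by have [g hg] := choice h; exists g.
have ginj := can_inj gE.
split=> [c12 z z' Fz Fz' zz'|E12].
  have [g' gK g'K] := inj_card_bij ginj (eq_leq (esym c12)).
  have finj : injective f.
    by move=> j j'; rewrite -(g'K j) -(g'K j') !gE => ->.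
  have [j jz] := FY2 z Fz; have [j' jz'] := FY2 z' Fz'.
  have [i iz] := FY1 z Fz; have [i' iz'] := FY1 z' Fz'.
  apply/(Y2E _ _ _ _ jz jz')/finj.
  by rewrite (fE _ _ _ jz iz) (fE _ _ _ jz' iz'); exact/(Y1E _ _ _ _ iz iz').
apply/eqP; rewrite eqn_leq (leq_card _ ginj) /=; apply: (leq_card f) => j j' ff.
have [z jz] := Y20 j; have [z' jz'] := Y20 j'.
have Fz := Y2F _ _ jz; have Fz' := Y2F _ _ jz'.
have [i iz] := FY1 z Fz; have [i' iz'] := FY1 z' Fz'.
apply/(Y2E _ _ _ _ jz jz')/E12 => //; apply/(Y1E _ _ _ _ iz iz').
by rewrite -(fE _ _ _ jz iz) -(fE _ _ _ jz' iz').
Qed.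

Variables (V : finType) (V0 : {set V}) (X : V -> set T) (F : set T).
Hypothesis V0_neq0 : V0 != finset.set0.
Hypothesis X_neq0 : forall v, v \in V0 -> X v !=set0.
Hypothesis FX : F = \bigcup_(v in [set` V0]) X v.

Let e : rel V := fun v w => `[< X v `&` X w !=set0 >].

Let e_sym : symmetric e.
Proof. by move=> v w; rewrite /e setIC. Qed.

(** A walk in the intersection graph corresponds to a chain of points, consecutive ones lying in a
    common [X v]. *)
Lemma graph_indexes : indexes F (eqv_span (fun z z' => exists v, [/\ v \in V0, X v z & X v z']))
  (fun i : 'I_#|graph_components V0 e| => \bigcup_(v in [set` enum_val i]) X v).
Proof.
have comp (i : 'I_#|graph_components V0 e|) v : v \in enum_val i ->
    v \in V0 /\ enum_val i = [set w in V0 | connect [rel u v | [&& u \in V0, v \in V0 & e u v]] v w]%SET.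
  by move=> h; have := graph_component_eq e_sym V0_neq0 (enum_valP i) h.
have share (i j : 'I_#|graph_components V0 e|) v w z : v \in enum_val i -> w \in enum_val j ->
    X v z -> X w z -> i = j.
  move=> vi wj vz wz; have [vV0 iE] := comp _ _ vi; have [wV0 jE] := comp _ _ wj.
  apply: enum_val_inj.
  have : w \in enum_val i.
    rewrite iE inE wV0 /=; apply: connect1; rewrite /= vV0 wV0 /=.
    by apply/asboolP; exists z.
  by move=> /comp[_ ->].
split.
- move=> i; have /(graph_componentsP e_sym V0_neq0)[v vV0 E] := enum_valP i.
  have [z vz] := X_neq0 vV0; exists z, v => //=.
  by rewrite E inE vV0 connect0.
- by move=> i z [v /= /comp[vV0 _] vz]; rewrite FX; exists v.
- move=> z; rewrite FX => -[v /= vV0 vz].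
  pose A := [set w in V0 | connect [rel u v | [&& u \in V0, v \in V0 & e u v]] v w]%SET.
  have AG : A \in graph_components V0 e by apply/(graph_componentsP e_sym V0_neq0); exists v.
  exists (enum_rank_in AG A), v => //=.
  by rewrite enum_rankK_in // inE vV0 connect0.
- move=> i j z z' iz jz'; split=> [zz'|ij].
    have : forall k : 'I_#|graph_components V0 e|,
      (\bigcup_(v in [set` enum_val k]) X v) z <-> (\bigcup_(v in [set` enum_val k]) X v) z'.
      move: zz'; apply: (@eqv_span_min _ _ (fun x y =>
        forall k : 'I_#|graph_components V0 e|, (\bigcup_(v in [set` enum_val k]) X v) x <->
          (\bigcup_(v in [set` enum_val k]) X v) y)).
        split=> // [x y h k|x y u h h' k]; first by rewrite h.
        by rewrite h.
      have half v x y (k : 'I_#|graph_components V0 e|) : v \in V0 -> X v x -> X v y ->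
        (\bigcup_(v in [set` enum_val k]) X v) x -> (\bigcup_(v in [set` enum_val k]) X v) y.
        move=> vV0 vx vy [w /= wk wx]; exists v => //=.
        have [wV0 ->] := comp _ _ wk; rewrite inE vV0 /=; apply: connect1.
        by rewrite /= wV0 vV0; apply/asboolP; exists x.
      by move=> x y [v [vV0 vx vy]] k; split; exact: (half v).
    move=> /(_ i)[/(_ iz)[v /= vi vz'] _]; have [w /= wj wz'] := jz'.
    exact: share vi wj vz' wz'.
  subst j; have [v /= vi vz] := iz; have [w /= wi wz'] := jz'.
  have [vV0 E] := comp _ _ vi; move: wi; rewrite E inE => /andP[_].
  move=> /connectP[p]; elim: p v vV0 z vz {vi E iz} => [|u p IH] v vV0 z vz /= => [_ E|].
    by subst w; apply: eqv_span_incl; exists v.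
  move=> /andP[/and3P[_ uV0 /asboolP[x [vx ux]]] pu] wE.
  apply: (@eqv_span_trans _ _ x); last exact: IH ux pu wE.
  by apply: eqv_span_incl; exists v.
Qed.

End Indexing.

(** * The level graphs of a fractal square *)

Section FractalSquare.
Context {R : realType} (N : nat) (D : {set digit N}) (F : set (R * R)).
Hypotheses (N_ge2 : (2 <= N)%N) (D_neq0 : D != finset.set0) (F_square : fractal_square D F).

Definition digit_vec (d : digit N) : int * int := (Posz d.1, Posz d.2).

Let Dz : set (int * int) := digit_vec @` [set` D].

Let cell_digit (d : digit N) : cell N (digit_vec d) = phi d :> (R * R -> R * R).
Proof. by []. Qed.

Lemma fractal_square_fractal : fractal N Dz F.
Proof.
have [F0 cF FE] := F_square; split=> //.
- by apply: finite_image; exact: finite_finset.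
- by move=> _ [d _ <-] /=; rewrite !ltz_nat !ltn_ord.
- rewrite {1}FE; apply/seteqP; split=> z.
    by move=> [d dD dz]; exists (digit_vec d) => //; exists d.
  by move=> [_ [d dD <-] dz]; exists d.
Qed.

Let frac := fractal_square_fractal.

Lemma digit_cell (d : digit N) p : d \in D -> F p -> F (phi d p).
Proof. by move=> dD Fp; rewrite -cell_digit; apply: (fractal_cell frac) => //; exists d. Qed.

Lemma indexes_level1 : indexes F (level N Dz F 1) (@piece R N D F).
Proof.
have [F0 cF FE] := F_square; have [z0 Fz0] := F0.
apply: indexes_ext (@graph_indexes _ _ D (fun d => phi d @` F) F D_neq0 _ FE); last first.
  by move=> d _; exists (phi d z0); exists z0.
move=> z z' _ _; split; apply: eqv_span_mono => {}z {}z'.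
  move=> [d [dD [p Fp <-] [p' Fp' <-]]]; exists (digit_vec d), p, p'; split=> //.
  by exists d.
move=> [_ [p [p' [[d dD <-] Fp Fp' _ [-> ->]]]]]; exists d; split=> //; [exists p|exists p'] => //.
Qed.

(** The vertex [(d, i)] carries the copy of class [i] in cell [d], so two points share a vertex
    exactly when they form a [cell_step]. *)
Lemma indexes_next (I : finType) (P : I -> set (R * R)) E : indexes F E P ->
  indexes F (refine_rel N Dz F E)
    (fun j : 'I_#|graph_components (level_vertices D I) (level_adj P)| =>
       \bigcup_(v in [set` enum_val j]) (phi v.1 @` P v.2)).
Proof.
move=> [P0 PF FP PE]; have [[z0 Fz0] cF FE] := F_square.
have inV v : (v \in level_vertices D I) = (v.1 \in D) by rewrite inE.
have V0 : level_vertices D I != finset.set0.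
  have [d dD] := finset.set0Pn _ D_neq0; have [i iz0] := FP _ Fz0.
  by apply/finset.set0Pn; exists (d, i); rewrite inV.
apply: indexes_ext (@graph_indexes _ _ (level_vertices D I) (fun v => phi v.1 @` P v.2) F V0 _ _).
- move=> z z' _ _; split; apply: eqv_span_mono => {}z {}z'.
    move=> [v [vV [p pP <-] [p' pP' <-]]]; exists (digit_vec v.1), p, p'; split=> //.
    + by exists v.1 => //=; rewrite -inV.
    + exact: PF pP.
    + exact: PF pP'.
    + exact/(PE _ _ _ _ pP pP').
  move=> [_ [p [p' [[d dD <-] Fp Fp' pp' [-> ->]]]]].
  have [i ip] := FP _ Fp; have [i' ip'] := FP _ Fp'.
  have ii' := (PE _ _ _ _ ip ip').1 pp'; subst i'.
  by exists (d, i); rewrite inV; split=> //; [exists p|exists p'].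
- by move=> v _; have [p pP] := P0 v.2; exists (phi v.1 p), p.
- apply/seteqP; split=> z.
    rewrite {1}FE => -[d dD [p Fp <-]]; have [i ip] := FP _ Fp.
    by exists (d, i); [rewrite /= inV|exists p].
  by move=> [v /=]; rewrite inV => vD [p pP <-]; apply: digit_cell => //; exact: PF pP.
Qed.

Lemma indexes_level2 : indexes F (level N Dz F 2) (@star_piece R N D F).
Proof. exact: indexes_next indexes_level1. Qed.

Lemma indexes_level3 : exists Y : 'I_#|level2_components D F| -> set (R * R),
  indexes F (level N Dz F 3) Y.
Proof. by eexists; exact: indexes_next indexes_level2. Qed.

(** The indices are shifted: components of the level-1 graph enumerate the classes of [level 2],
    those of the level-2 graph the classes of [level 3]. *)
Lemma card_components_eq : #|level1_components D F| = #|level2_components D F| <->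
  (forall z z', F z -> F z' -> level N Dz F 2 z z' -> level N Dz F 3 z z').
Proof.
have [Y hY] := indexes_level3.
have := indexes_card indexes_level2 hY (@level_anti _ N Dz F 2).
by rewrite !card_ord.
Qed.

Lemma card_components n (Y : 'I_n -> set (R * R)) :
  indexes F (same_comp F) Y -> components F #= `I_n.
Proof.
move=> [Y0 YF FY YE].
have YC i z : Y i z -> connected_component F z = Y i.
  move=> iz; apply/seteqP; split=> [u zu|u iu]; last exact/(YE _ _ _ _ iz iu).
  have [_ Fu] := same_comp_in zu; have [j ju] := FY _ Fu.
  by have -> := (YE _ _ _ _ iz ju).1 zu.
have -> : components F = Y @` setT.
  apply/seteqP; split=> [_ [z Fz <-]|_ [i _ <-]].
    by have [i iz] := FY _ Fz; exists i => //; exact/esym/YC.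
  by have [z iz] := Y0 i; exists z; [exact: YF iz|exact: YC].
have Yinj : {in [set: 'I_n] &, injective Y}.
  move=> i j _ _ E; have [z iz] := Y0 i; have jz : Y j z by rewrite -E.
  apply/(YE _ _ _ _ iz jz); exact: connected_component_refl (YF _ _ iz).
apply: card_eq_trans (inj_card_eq Yinj) _.
by rewrite card_eq_sym; exact: card_II.
Qed.

(** A saturated set is a finite union of components, each of which is closed. *)
Lemma finite_components_closed : finite_set (components F) -> closed_classes F (same_comp F).
Proof.
move=> fin G GS.
have -> : F `&` G = \bigcup_(C in components F `&` [set C | C `<=` G]) C.
  apply/seteqP; split=> [z [Fz Gz]|z [C [[u Fu <-] CG] uz]].
    exists (connected_component F z); last exact: connected_component_refl.
    split; first by exists z.
    by move=> u zu; have [_ Fu] := same_comp_in zu; exact: GS zu Gz.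
  by split; [exact: connected_component_sub uz|exact: CG].
apply: closed_bigcup; first exact: finite_setIl.
by move=> _ [[u Fu <-] _]; apply: component_closed; exact: fractal_closed frac.
Qed.

Lemma disconnected_same_comp : ~ connected F -> exists z z', [/\ F z, F z' & ~ same_comp F z z'].
Proof.
move=> nF; apply: contrapT => h; apply: nF; have [[z Fz] _ _] := F_square.
suff -> : F = connected_component F z by exact: component_connected.
apply/seteqP; split=> [u Fu|]; last exact: connected_component_sub.
by apply: contrapT => nzu; apply: h; exists z, u.
Qed.

Lemma stable_same_comp :
  (forall z z', F z -> F z' -> level N Dz F 2 z z' -> level N Dz F 3 z z') ->
  forall z z', F z -> F z' -> (level N Dz F 2 z z' <-> same_comp F z z').
Proof.
move=> h z z' Fz Fz'; split; last exact: same_comp_level frac _ _ _.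
apply: (refine_fixed_same_comp frac) => //; first exact: level_equiv.
  exact: closed_classes_level.
by move=> u u'; exact: (@level_anti _ N Dz F 2).
Qed.

End FractalSquare.

Theorem theorem1p6 (R : realType) (N : nat) (D : {set digit N})
    (F : set (R * R)) (N_ge2 : (2 <= N)%N) (D_neq0 : D != finset.set0)
    (F_square : fractal_square D F) (F_disconnected : ~ connected F) :
  (finite_set (components F) <->
     #|level1_components D F| = #|level2_components D F|) /\
  (#|level1_components D F| = #|level2_components D F| ->
     components F #= `I_#|level1_components D F|).
Proof.
have frac := fractal_square_fractal N_ge2 F_square.
have card_eq : #|level1_components D F| = #|level2_components D F| ->
     components F #= `I_#|level1_components D F|.
  move=> /(card_components_eq N_ge2 D_neq0 F_square) /(stable_same_comp N_ge2 F_square) h.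
  apply: card_components; apply: indexes_ext (indexes_level2 N_ge2 D_neq0 F_square).
  exact: h.
split=> //; split=> [fin|/card_eq c]; last first.
  by apply/finite_setP; eexists; exact: c.
have clopen := finite_components_closed N_ge2 F_square fin.
have disc := disconnected_same_comp F_square F_disconnected.
(* Finiteness puts [level 2] inside [same_comp], which lies inside every level. *)
apply/(card_components_eq N_ge2 D_neq0 F_square) => z z' Fz Fz' zz'.
exact/(same_comp_level frac)/(level2_same_comp frac clopen disc Fz Fz' zz').
Qed.
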